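(* Let $n>2$ and $g\ge 2$. For each of the four natural projections $$\alpha:\mathrm{Aut}\,F_n\to \mathrm{Out}\,F_n,\quad \beta:\mathrm{Out}\,F_n\to GL(n,\mathbb Z),\quad \gamma:\mathrm{Aut}\,\pi_1\mathcal F_g\to \mathrm{Out}\,\pi_1\mathcal F_g,\quad \delta:\mathrm{Out}_+\pi_1\mathcal F_g\to Sp(2g,\mathbb Z),$$ there exists a finite cyclic subgroup of the target group which does not lift to the source group. *)

(* Defs.v *)
(* Free groups as reduced words, endomorphisms given by the
   images of the generators, the closed orientable surface group of genus g
   as F_{2g} modulo the normal closure of prod_i [a_i, b_i]. *)
From mathcomp Require Import all_boot all_algebra.
Set Implicit Arguments. Unset Strict Implicit. Unset Printing Implicit Defensive.
Import GRing.Theory Num.Theory.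

(* a letter (x, false) is x, (x, true) is x^-1 *)
Definition word (X : Type) := seq (X * bool).

Definition winv (X : Type) (w : word X) : word X :=
  rev [seq (p.1, ~~ p.2) | p <- w].

Definition push (X : eqType) (l : X * bool) (s : word X) : word X :=
  match s with
  | y :: s' => if (y.1 == l.1) && (y.2 != l.2) then s' else l :: s
  | [::] => [:: l]
  end.

(* free reduction: two words represent the same element of F(X) iff they
   have the same reduction *)
Definition reduce (X : eqType) (w : word X) : word X := foldr (@push X) [::] w.

Definition gen (X : Type) (x : X) : word X := [:: (x, false)].

(* an endomorphism of F(X), given by the images of the generators *)
Definition endo (X : Type) := X -> word X.

Definition ext (X : eqType) (e : endo X) (w : word X) : word X :=
  reduce (flatten [seq if p.2 then winv (e p.1) else e p.1 | p <- w]).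

Definition ecomp (X : eqType) (e1 e2 : endo X) : endo X := fun x => ext e1 (e2 x).
Definition eid (X : Type) : endo X := @gen X.
Definition epow (X : eqType) (e : endo X) (m : nat) : endo X := iter m (ecomp e) (@eid X).

Definition conj_by (X : Type) (w : word X) (e : endo X) : endo X :=
  fun x => w ++ e x ++ winv w.

Definition feq (X : eqType) (e1 e2 : endo X) := forall x, reduce (e1 x) = reduce (e2 x).

Definition is_aut_free (X : eqType) (e : endo X) :=
  exists e' : endo X, feq (ecomp e e') (@eid X) /\ feq (ecomp e' e) (@eid X).

Definition inner_free (X : eqType) (e : endo X) :=
  exists w : word X, feq e (conj_by w (@eid X)).

Definition expsum (X : eqType) (x : X) (w : word X) : int :=
  ((count_mem (x, false) w)%:Z - (count_mem (x, true) w)%:Z)%R.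

(* the matrix of the induced map on H_1 = Z^n (column j = image of generator j) *)
Definition abmx (n : nat) (e : endo 'I_n) : 'M[int]_n :=
  \matrix_(i, j) expsum i (e j).

Definition mxpow (n : nat) (A : 'M[int]_n) (m : nat) : 'M[int]_n :=
  iter m (mulmx A) (1%:M)%R.

(* ---------- surface group pi_1 of the closed orientable surface of genus g ----
   generators of F_{2g} indexed by 'I_(2*g): a_k = 2k, b_k = 2k+1 *)
Lemma aidx_lt (g : nat) (k : 'I_g) : k.*2 < 2 * g.
Proof. by rewrite mul2n ltn_double. Qed.
Lemma bidx_lt (g : nat) (k : 'I_g) : k.*2.+1 < 2 * g.
Proof. by rewrite mul2n ltn_Sdouble. Qed.
Definition sa (g : nat) (k : 'I_g) : 'I_(2 * g) := Ordinal (aidx_lt k).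
Definition sb (g : nat) (k : 'I_g) : 'I_(2 * g) := Ordinal (bidx_lt k).

Definition commw (X : Type) (u v : word X) : word X := u ++ v ++ winv u ++ winv v.

Definition rel (g : nat) : word 'I_(2 * g) :=
  flatten [seq commw (gen (sa k)) (gen (sb k)) | k <- enum 'I_g].

(* membership in the normal closure N of the relator *)
Definition inN (g : nat) (w : word 'I_(2 * g)) :=
  exists l : seq (word 'I_(2 * g) * bool),
    reduce w = reduce (flatten [seq c.1 ++ (if c.2 then winv (rel g) else rel g)
                                     ++ winv c.1 | c <- l]).

Definition eqN (g : nat) (u v : word 'I_(2 * g)) := inN (u ++ winv v).

(* equality of induced endomorphisms of pi_1 = F_{2g}/N *)
Definition seqv (g : nat) (e1 e2 : endo 'I_(2 * g)) := forall x, eqN (e1 x) (e2 x).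

(* e descends to an endomorphism of pi_1 *)
Definition wd (g : nat) (e : endo 'I_(2 * g)) := inN (ext e (rel g)).

Definition is_aut_surf (g : nat) (e : endo 'I_(2 * g)) :=
  wd e /\ exists e' : endo 'I_(2 * g),
    wd e' /\ seqv (ecomp e e') (@eid _) /\ seqv (ecomp e' e) (@eid _).

Definition inner_surf (g : nat) (e : endo 'I_(2 * g)) :=
  exists w : word 'I_(2 * g), seqv e (conj_by w (@eid _)).

(* intersection form on H_1 = Z^{2g} in the basis a_1,b_1,...: a_k.b_k = 1 *)
Definition Jmx (g : nat) : 'M[int]_(2 * g) :=
  \matrix_(i, j) (if odd j && (i.+1 == j :> nat) then 1%R
                  else if odd i && (j.+1 == i :> nat) then (-1)%R else 0%R).

Definition is_sp (g : nat) (A : 'M[int]_(2 * g)) := (A^T *m Jmx g *m A)%R = Jmx g.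

(* orientation preserving: the induced action on H_1 preserves the
   intersection (cup product) form, i.e. acts as +1 on H_2 *)
Definition orient_pres (g : nat) (e : endo 'I_(2 * g)) := is_sp (abmx e).

(* alpha : Aut F_n -> Out F_n.  [phi] has order m in Out F_n, and no lift
   inn_w o phi of [phi] has order dividing m in Aut F_n. *)
Definition nonlift_alpha (n : nat) :=
  exists (phi : endo 'I_n) (m : nat),
    [/\ is_aut_free phi, 0 < m, inner_free (epow phi m),
        (forall k, 0 < k < m -> ~ inner_free (epow phi k)) &
        forall w : word 'I_n, ~ feq (epow (conj_by w phi) m) (@eid _)].

Definition nonlift_beta (n : nat) :=
  exists (A : 'M[int]_n) (m : nat),
    [/\ A \in unitmx, 0 < m, mxpow A m = (1%:M)%R,
        (forall k, 0 < k < m -> mxpow A k <> (1%:M)%R) &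
        forall phi : endo 'I_n, is_aut_free phi -> abmx phi = A ->
          ~ inner_free (epow phi m)].

Definition nonlift_gamma (g : nat) :=
  exists (phi : endo 'I_(2 * g)) (m : nat),
    [/\ is_aut_surf phi, 0 < m, inner_surf (epow phi m),
        (forall k, 0 < k < m -> ~ inner_surf (epow phi k)) &
        forall w : word 'I_(2 * g), ~ seqv (epow (conj_by w phi) m) (@eid _)].

Definition nonlift_delta (g : nat) :=
  exists (A : 'M[int]_(2 * g)) (m : nat),
    [/\ is_sp A, 0 < m, mxpow A m = (1%:M)%R,
        (forall k, 0 < k < m -> mxpow A k <> (1%:M)%R) &
        forall phi : endo 'I_(2 * g), is_aut_surf phi -> orient_pres phi ->
          abmx phi = A -> ~ inner_surf (epow phi m)].

(* Main.v *)
Require Import Defs.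
From mathcomp Require Import all_boot all_algebra ring zify.
From Stdlib Require Import Setoid Morphisms.
Set Implicit Arguments. Unset Strict Implicit. Unset Printing Implicit Defensive.
Import GRing.Theory Num.Theory.

(** Lifting from Out to Aut.  If phi^m is conjugation by v and the lift (conj_w phi)^m is
    trivial, then z = w phi(w) ... phi^(m-1)(w) v is central, so its low order Magnus
    coefficients vanish.  For deck transformations of free actions these coefficients can be
    computed and are nonzero: F_n is the fundamental group of a circle of length n - 1 with
    a loop at each vertex, rotated by one step; the surface of odd genus carries a free
    orientation preserving involution, the one of even genus an antipodal map.

    Lifting to Out.  The matrix A of order 6 is the sum of [[0, -1], [1, 1]] and an identity
    block.  Let phi induce A and let phi^6 be conjugation by w.  As A^3 = 1 mod 2, the map
    phi^3 is 1 + d + ... on the Magnus algebra mod 2, where d is a derivation of degree one.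
    Dually, d is a commutative product on V = H^1(-; F_2) commuting with phi^*; the identity
    phi^6 = conj_w becomes d^2 = [w_2, -], which says that the associator of the product is
    q(a, b) c + q(b, c) a, where q is given by the second order coefficients of w.  The
    action of A^3 modulo 4 gives the squares: a a = a on the plane where A^3 = -1 and
    a a = 0 on its complement Z.  (F_2 + V is then an associative ring, the mod 2 cohomology
    of the fixed point set of an involution realizing phi^3.)  Since phi^* permutes
    cyclically the three nonzero elements of the plane, no such product exists unless
    Z = 0.  For a surface group all of this holds up to multiples of the intersection form,
    and the contradiction arises from two elements of Z that are dual for this form. *)

(** * Free reduction and one-relator quotients *)

Section FreeReduction.
Variable X : eqType.
Implicit Types (l : X * bool) (u v w s : word X) (e f : endo X).

Definition weq u v := reduce u = reduce v.

Definition linv l : X * bool := (l.1, ~~ l.2).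

Definition reduced : pred (word X) := sorted (fun l m => ~~ ((m.1 == l.1) && (m.2 != l.2))).

Lemma push_reduced l s : reduced s -> reduced (push l s).
Proof.
case: s => [|m s] //= ms; case: ifP => [_|nc]; first exact: path_sorted ms.
by rewrite /= nc.
Qed.

Lemma reduce_reduced u : reduced (reduce u).
Proof. by elim: u => //= l u IH; apply: push_reduced. Qed.

(** Reducedness matters when [linv l] cancels the head of [s]: that head is [l], and putting it back
    must not cancel against the next letter. *)
Lemma pushK l s : reduced s -> push l (push (linv l) s) = s.
Proof.
case: l s => x b [|[y c] s] /=; first by rewrite eqxx /=; case: b.
case: (eqVneq y x) => [->|nyx] /=; last by rewrite eqxx; case: b.
have -> : (c != ~~ b) = (c == b) by case: b c => [] [].
case: (eqVneq c b) => [->|ncb] /=; last by rewrite eqxx; case: b ncb.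
by case: s => [|[z d] s] //= /andP[/negPf ->].
Qed.

Lemma foldr_push_reduced u s : reduced s -> reduced (foldr (@push X) s u).
Proof. by move=> rs; elim: u => //= l u IH; apply: push_reduced. Qed.

Lemma foldr_push_push l u s : reduced s ->
  foldr (@push X) s (push l u) = push l (foldr (@push X) s u).
Proof.
case: u => [|[y c] u] //= rs; case: ifP => //= /andP[/eqP/= yl cl].
have -> : (y, c) = linv l by rewrite /linv yl; case: (l.2) c cl => [] [].
by rewrite pushK //; apply: foldr_push_reduced.
Qed.

(** Van der Waerden's trick: by [pushK] the letters act on reduced words as mutually inverse
    bijections, so a word and its reduction act alike. *)
Lemma foldr_push_reduce u s : reduced s ->
  foldr (@push X) s (reduce u) = foldr (@push X) s u.
Proof. by move=> rs; elim: u => //= l u IH; rewrite foldr_push_push // IH. Qed.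

Lemma reduce_cat u v : reduce (u ++ v) = foldr (@push X) (reduce v) u.
Proof. by rewrite /reduce foldr_cat. Qed.

Lemma weq_reduce u : weq (reduce u) u.
Proof. exact: (foldr_push_reduce u (isT : reduced [::])). Qed.

Lemma weq_cat u u' v v' : weq u u' -> weq v v' -> weq (u ++ v) (u' ++ v').
Proof.
rewrite /weq !reduce_cat => uu' ->.
by rewrite -foldr_push_reduce ?uu' ?foldr_push_reduce //; apply: reduce_reduced.
Qed.

Lemma winv_cat u v : winv (u ++ v) = winv v ++ winv u.
Proof. by rewrite /winv map_cat rev_cat. Qed.

Lemma winv_cons l u : winv (l :: u) = winv u ++ [:: linv l].
Proof. by rewrite -cat1s winv_cat. Qed.

Lemma winvK : involutive (@winv X).
Proof.
move=> u; rewrite /winv map_rev revK -map_comp -[RHS]map_id.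
by apply: eq_map => -[x b] /=; rewrite negbK.
Qed.

Lemma weq_cat_winv u : weq (u ++ winv u) [::].
Proof.
elim: u => [|l u IH] //; rewrite winv_cons -cat1s -catA (catA u).
rewrite /weq -[RHS]/(reduce ([::] ++ [::])) reduce_cat /=.
have := @weq_cat _ _ [:: linv l] [:: linv l] IH (erefl _); rewrite /weq => -> /=.
by case: l => x b /=; rewrite eqxx /=; case: b.
Qed.

Lemma weq_winv_cat u : weq (winv u ++ u) [::].
Proof. by rewrite -{2}(winvK u); apply: weq_cat_winv. Qed.

(** [ext] before the final reduction, so that concatenation and inversion are respected
    literally. *)
Definition subst e u := flatten [seq if p.2 then winv (e p.1) else e p.1 | p <- u].

Lemma weq_ext e u : weq (ext e u) (subst e u).
Proof. exact: weq_reduce. Qed.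

Lemma subst_cat e u v : subst e (u ++ v) = subst e u ++ subst e v.
Proof. by rewrite /subst map_cat flatten_cat. Qed.

Lemma subst_winv e u : subst e (winv u) = winv (subst e u).
Proof.
elim: u => [|[x b] u IH] //; rewrite winv_cons subst_cat IH -[in RHS]cat1s subst_cat winv_cat.
by congr (_ ++ _); rewrite /subst /= !cats0; case: b => //=; rewrite winvK.
Qed.

End FreeReduction.

Section Quotient.
Variables (X : eqType) (r : word X).
Implicit Types (u v w : word X) (e f : endo X).

(** [inN] and [eqN] for an arbitrary relator: [rel g] gives the surface group, and the empty relator
    gives the free group, so that both are treated at once. *)
Definition relators (l : seq (word X * bool)) : word X :=
  flatten [seq c.1 ++ (if c.2 then winv r else r) ++ winv c.1 | c <- l].

Definition in_ncl u := exists l, reduce u = reduce (relators l).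

Lemma in_ncl_weq u v : weq u v -> in_ncl u -> in_ncl v.
Proof. by move=> uv [l ul]; exists l; rewrite -uv. Qed.

Lemma in_ncl_nil : in_ncl [::].
Proof. by exists [::]. Qed.

Lemma in_ncl_cat u v : in_ncl u -> in_ncl v -> in_ncl (u ++ v).
Proof.
move=> [k uk] [l vl]; exists (k ++ l).
by rewrite /relators map_cat flatten_cat; apply: weq_cat.
Qed.

Lemma weq_winv u v : weq u v -> weq (winv u) (winv v).
Proof.
move=> uv; have h1 : weq (winv u ++ (u ++ winv v)) (winv v).
  rewrite catA -[X in weq _ X]cat0s; apply: weq_cat => //; exact: weq_winv_cat.
rewrite /weq -h1 -[in LHS](cats0 (winv u)); apply: weq_cat => //; apply/esym.
rewrite -(weq_cat_winv v); exact: weq_cat.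
Qed.

Lemma in_ncl_winv u : in_ncl u -> in_ncl (winv u).
Proof.
move=> [l ul]; exists (rev [seq (c.1, ~~ c.2) | c <- l]); rewrite (weq_winv ul).
congr reduce; elim: l {ul} => [|[c b] l IH] //=; rewrite winv_cat IH rev_cons -cats1.
rewrite /relators map_cat flatten_cat /= cats0; congr (_ ++ _).
by rewrite !winv_cat winvK -catA; case: b => //=; rewrite winvK.
Qed.

Lemma in_ncl_conj w u : in_ncl u -> in_ncl (w ++ u ++ winv w).
Proof.
move=> [l ul]; exists [seq (w ++ c.1, c.2) | c <- l].
transitivity (reduce (w ++ relators l ++ winv w)); first by do 2![apply: weq_cat => //].
elim: l {ul} => [|[c b] l IH] /=; first exact: weq_cat_winv.
rewrite /relators /= -/(relators _) -/(relators _).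
transitivity (reduce ((w ++ (c ++ (if b then winv r else r) ++ winv c) ++ winv w) ++
  (w ++ relators l ++ winv w))).
  rewrite -!catA; do 4![apply: weq_cat => //]; rewrite (catA (winv w)).
  by rewrite -[X in weq X _]cat0s; apply: weq_cat => //; rewrite /weq weq_winv_cat.
by rewrite winv_cat; apply: weq_cat; rewrite // -!catA.
Qed.

Lemma in_ncl_rel : in_ncl r.
Proof. by exists [:: ([::], false)]; rewrite /relators /= !cats0. Qed.

Definition eqr u v := in_ncl (u ++ winv v).

Lemma weq_eqr u v : weq u v -> eqr u v.
Proof.
move=> uv; apply: in_ncl_weq in_ncl_nil; apply/esym; rewrite -(weq_cat_winv v).
exact: weq_cat.
Qed.

Lemma eqr_refl u : eqr u u.
Proof. exact: weq_eqr. Qed.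

Lemma eqr_sym u v : eqr u v -> eqr v u.
Proof. by move/in_ncl_winv; rewrite /eqr winv_cat winvK. Qed.

Lemma eqr_trans v u w : eqr u v -> eqr v w -> eqr u w.
Proof.
move=> uv vw; apply: in_ncl_weq (in_ncl_cat uv vw); rewrite -catA; apply: weq_cat => //.
by rewrite catA -[X in weq _ X]cat0s; apply: weq_cat => //; apply: weq_winv_cat.
Qed.

Lemma eqr_cat u u' v v' : eqr u u' -> eqr v v' -> eqr (u ++ v) (u' ++ v').
Proof.
(* [u v v'^-1 u'^-1 = (u v v'^-1 u^-1) (u u'^-1)], and the normal closure is stable under
   conjugation. *)
move=> uu' vv'; apply: in_ncl_weq (in_ncl_cat (in_ncl_conj u vv') uu').
rewrite winv_cat -!catA; do 3![apply: weq_cat => //].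
by rewrite catA -[X in weq _ X]cat0s; apply: weq_cat => //; apply: weq_winv_cat.
Qed.

Lemma eqr_winv u v : eqr u v -> eqr (winv u) (winv v).
Proof.
move=> /(in_ncl_conj (winv u))/in_ncl_winv uv; rewrite /eqr winvK; apply: in_ncl_weq uv.
rewrite !winv_cat !winvK -!catA; apply: weq_cat => //; rewrite -[X in weq _ X]cats0.
by apply: weq_cat => //; apply: weq_winv_cat.
Qed.

Lemma eqr_catVK u v : eqr (u ++ winv u ++ v) v.
Proof.
by apply: weq_eqr; rewrite catA -[X in weq _ X]cat0s; apply: weq_cat => //; apply: weq_cat_winv.
Qed.

Lemma eqr_catKV u v : eqr (winv u ++ u ++ v) v.
Proof. by rewrite -{2}(winvK u); apply: eqr_catVK. Qed.

Lemma eqr_catV u : eqr (u ++ winv u) [::].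
Proof. by have := eqr_catVK u [::]; rewrite cats0. Qed.

Lemma eqr_Vcat u : eqr (winv u ++ u) [::].
Proof. by rewrite -{2}(winvK u); apply: eqr_catV. Qed.

Lemma in_nclP u : in_ncl u <-> eqr u [::].
Proof. by rewrite /eqr cats0. Qed.

End Quotient.

#[export] Hint Resolve eqr_refl : core.

#[export] Instance eqr_equivalence (X : eqType) (r : word X) : Equivalence (eqr r).
Proof.
by split; [exact: eqr_refl | exact: eqr_sym | move=> u v w; exact: eqr_trans].
Qed.

#[export] Instance cat_eqr_proper (X : eqType) (r : word X) :
  Proper (eqr r ==> eqr r ==> eqr r) (@cat (X * bool)).
Proof. by move=> u u' uu' v v' vv'; apply: eqr_cat. Qed.

#[export] Instance winv_eqr_proper (X : eqType) (r : word X) :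
  Proper (eqr r ==> eqr r) (@winv X).
Proof. by move=> u v; apply: eqr_winv. Qed.

Section Endomorphisms.
Variables (X : eqType) (r : word X).
Implicit Types (u v w : word X) (e f : endo X).

Lemma eqr_nil u v : eqr [::] u v <-> reduce u = reduce v.
Proof.
split=> [[l]|]; last exact: weq_eqr.
have -> : reduce (relators [::] l) = [::].
  elim: l => [|[c b] l IH] //; rewrite /relators /= -/(relators _ _).
  have -> : (if b then winv [::] else [::]) = [::] :> word X by case: b.
  by rewrite -[RHS]/(reduce (Nil (X * bool) ++ [::])); apply: weq_cat; rewrite // cat0s;
    apply: weq_cat_winv.
move=> uv0; have := weq_cat (uv0 : weq _ [::]) (erefl (reduce v)).
rewrite /= /weq => <-; rewrite -catA -[in LHS](cats0 u); apply: weq_cat => //.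
by apply/esym; apply: weq_winv_cat.
Qed.

Lemma eqr0_eqr u v : eqr [::] u v -> eqr r u v.
Proof. by move/eqr_nil/weq_eqr. Qed.

Lemma eqr_ext e u : eqr r (ext e u) (subst e u).
Proof. exact: weq_eqr (weq_ext e u). Qed.

(** The condition for [e] to descend to the quotient; it is [wd e] when [r] is [rel g]. *)
Definition ext_stable e := in_ncl r (ext e r).

Lemma ext_cat e u v : eqr r (ext e (u ++ v)) (ext e u ++ ext e v).
Proof. by rewrite !eqr_ext subst_cat. Qed.

Lemma ext_winv e u : eqr r (ext e (winv u)) (winv (ext e u)).
Proof. by rewrite !eqr_ext subst_winv. Qed.

Lemma ext_gen e x : eqr r (ext e (gen x)) (e x).
Proof. by rewrite eqr_ext /subst /= cats0. Qed.

Lemma subst_weq e u v : weq u v -> weq (subst e u) (subst e v).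
Proof.
have red w : weq (subst e (reduce w)) (subst e w).
  elim: w => [|l w IH] //=; transitivity (reduce (subst e (l :: reduce w))); last first.
    by rewrite /weq -cat1s subst_cat -[in RHS]cat1s subst_cat; apply: weq_cat.
  case: (reduce w) => [|[y c] s] //=; case: ifP => //= /andP[/eqP yl cl].
  rewrite -[in RHS]cat1s -[(y, c) :: s]cat1s catA subst_cat /subst /= cats0.
  rewrite -[in LHS](cat0s (flatten _)); apply: weq_cat => //; apply/esym.
  rewrite yl; case: (l.2) c cl => [] [] // _; [exact: weq_winv_cat|exact: weq_cat_winv].
by move=> uv; rewrite /weq -red uv red.
Qed.

Lemma ext_eqr e u v : ext_stable e -> eqr r u v -> eqr r (ext e u) (ext e v).
Proof.
move=> er [l uvl]; suff: in_ncl r (subst e (relators r l)).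
  move=> eN; rewrite !eqr_ext /eqr -subst_winv -subst_cat; apply: in_ncl_weq eN.
  exact: subst_weq.
elim: l {uvl} => [|[c b] l IH]; first exact: in_ncl_nil.
rewrite /relators /= -/(relators _ _) subst_cat; apply: in_ncl_cat => //.
rewrite !subst_cat subst_winv; apply: in_ncl_conj.
have sr : in_ncl r (subst e r) by apply: in_ncl_weq er; apply: weq_ext.
by case: b => //; rewrite subst_winv; apply: in_ncl_winv.
Qed.

End Endomorphisms.

Lemma ext_stable_nil (X : eqType) (e : endo X) : ext_stable [::] e.
Proof. exact: in_ncl_nil. Qed.

#[export] Instance ext_eqr0_proper (X : eqType) (e : endo X) :
  Proper (eqr [::] ==> eqr [::]) (ext e).
Proof. by move=> u v; apply: ext_eqr; apply: ext_stable_nil. Qed.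

(** * Powers of endomorphisms and of their conjugates *)

Section Powers.
Variables (X : eqType).
Implicit Types (u v w : word X) (e f : endo X) (k : nat).

Lemma ext_eid u : eqr [::] (ext (@eid X) u) u.
Proof.
rewrite eqr_ext; suff -> : subst (@eid X) u = u by [].
by elim: u => [|[x []] u IH] //; rewrite -cat1s subst_cat IH.
Qed.

(** A map that is multiplicative modulo [r] is determined by its values on generators; compositions
    and conjugations are identified in this way. *)
Lemma ext_unique (r : word X) (F : word X -> word X) e :
  (forall u v, eqr r (F (u ++ v)) (F u ++ F v)) ->
  (forall u, eqr r (F (winv u)) (winv (F u))) -> eqr r (F [::]) [::] ->
  (forall x, eqr r (F (gen x)) (e x)) -> forall u, eqr r (F u) (ext e u).
Proof.
move=> Fcat Fwinv F0 Fgen u; rewrite eqr_ext; elim: u => [|[x b] u IH] //.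
rewrite -cat1s Fcat subst_cat IH; apply: eqr_cat => //; rewrite /subst /= cats0.
by case: b; rewrite -?Fgen // -Fwinv.
Qed.

Lemma ext_ecomp e f u : eqr [::] (ext (ecomp e f) u) (ext e (ext f u)).
Proof.
apply: eqr_sym; apply: (@ext_unique [::] (fun u => ext e (ext f u))) => [{}u v|{}u||x] //.
- by rewrite !ext_cat.
- by rewrite !ext_winv.
- by rewrite /ecomp ext_gen.
Qed.

Lemma epowS e k x : epow e k.+1 x = ext e (epow e k x).
Proof. by []. Qed.

Lemma ext_epowS e k u : eqr [::] (ext (epow e k.+1) u) (ext e (ext (epow e k) u)).
Proof. exact: ext_ecomp. Qed.

Lemma ext_epowSr e k u : eqr [::] (ext (epow e k.+1) u) (ext (epow e k) (ext e u)).
Proof.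
elim: k u => [|k IH] u; first by rewrite ext_epowS !ext_eid.
by rewrite ext_epowS IH -ext_epowS.
Qed.

Lemma ext_epowD e k l u :
  eqr [::] (ext (epow e (k + l)) u) (ext (epow e k) (ext (epow e l) u)).
Proof.
elim: k => [|k IH]; first by rewrite ext_eid.
by rewrite addSn ext_epowS IH -ext_epowS.
Qed.

Lemma ext_conj_by w e u : eqr [::] (ext (conj_by w e) u) (w ++ ext e u ++ winv w).
Proof.
apply: eqr_sym; apply: (@ext_unique [::] (fun u => w ++ ext e u ++ winv w)) => [{}u v|{}u||x].
- by rewrite ext_cat -!catA eqr_catKV.
- by rewrite ext_winv !winv_cat winvK -catA.
- exact: eqr_catV.
- by rewrite ext_gen.
Qed.

(** The cocycle [w e(w) ... e^(k-1)(w)]: the k-th power of [conj_by w e] is [e^k] followed by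
    conjugation by it. *)
Fixpoint conj_pow w e k : word X :=
  if k is k'.+1 then w ++ ext e (conj_pow w e k') else [::].

Lemma epow_conj_by w e k x :
  eqr [::] (epow (conj_by w e) k x)
           (conj_pow w e k ++ epow e k x ++ winv (conj_pow w e k)).
Proof.
elim: k => [|k IH]; first exact: eqr_refl.
by rewrite epowS IH -/conj_pow ext_conj_by !ext_cat ext_winv winv_cat -!catA.
Qed.

End Powers.

Section InnerPower.
Variables (X : eqType) (r : word X) (e : endo X) (m : nat) (v : word X).
Hypotheses (er : ext_stable r e) (em : forall x, eqr r (epow e m x) (v ++ gen x ++ winv v)).

Lemma ext_stable_epow k : ext_stable r (epow e k).
Proof.
elim: k => [|k /in_nclP IH]; rewrite /ext_stable; apply/in_nclP.
  rewrite (eqr0_eqr _ (ext_eid _)); exact: (proj1 (in_nclP _ _) (in_ncl_rel r)).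
by rewrite (eqr0_eqr _ (ext_epowS _ _ _)) (ext_eqr er IH).
Qed.

Lemma ext_epow_inner u : eqr r (ext (epow e m) u) (v ++ u ++ winv v).
Proof.
apply: eqr_sym; apply: (@ext_unique _ r (fun u => v ++ u ++ winv v)) => [{}u w|{}u||x].
- by rewrite -!catA eqr_catKV.
- by rewrite !winv_cat winvK -catA.
- exact: eqr_catV.
- by rewrite em.
Qed.

(** The m-th power of [conj_by w e] is conjugation by [z]; when it is trivial, [z] commutes with
    every generator. *)
Lemma conj_pow_central w :
  (forall x, eqr r (epow (conj_by w e) m x) (gen x)) ->
  forall x, let z := conj_pow w e m ++ v in eqr r (z ++ gen x) (gen x ++ z).
Proof.
move=> h x z; rewrite {}/z; have := h x; rewrite (eqr0_eqr _ (epow_conj_by w e m x)) em => hx.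
rewrite -{2}hx -!catA eqr_catKV.
by rewrite eqr_Vcat cats0.
Qed.

Hypotheses (ev : eqr r (ext e v) v) (m_gt0 : 0 < m).

Lemma inner_power_invertible : exists e' : endo X,
  [/\ ext_stable r e', forall x, eqr r (ecomp e e' x) (gen x) &
      forall x, eqr r (ecomp e' e x) (gen x)].
Proof.
(* The inverse is [e^(m-1)] followed by conjugation by [v^-1]. That [e] fixes [v] makes it a right
   inverse. *)
case: m m_gt0 em ext_epow_inner => // k _ emk extk; exists (conj_by (winv v) (epow e k)).
split=> [|x|x].
- rewrite /ext_stable; apply/in_nclP; rewrite (eqr0_eqr _ (ext_conj_by _ _ _)).
  by move/in_nclP: (ext_stable_epow k) => ->; rewrite winvK cat0s eqr_Vcat.
- rewrite /ecomp /conj_by !ext_cat winvK !ext_winv ev -epowS emk.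
  by rewrite -!catA eqr_catKV eqr_Vcat cats0.
- rewrite /ecomp (eqr0_eqr _ (ext_conj_by _ _ _)) winvK.
  have -> : eqr r (ext (epow e k) (e x)) (epow e k.+1 x).
    apply: eqr0_eqr; rewrite -[X in eqr _ (ext _ X)]/(e x) -(ext_gen [::] e x) -ext_epowSr.
    exact: ext_gen.
  by rewrite emk -!catA eqr_catKV eqr_Vcat cats0.
Qed.

End InnerPower.

Local Open Scope ring_scope.

(** * Magnus coefficients of degree at most three *)

(* The coefficients of the Magnus expansion x |-> 1 + X, x^-1 |-> 1 - X + X^2 - X^3,
   contracted with the linear forms a, b, c on the span of the variables. *)
Section Magnus.
Variables (R : comNzRingType) (X : finType).
Implicit Types (a b c : {ffun X -> R}) (l : X * bool) (u v w : word X) (e : endo X).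

Definition letter1 a l : R := if l.2 then - a l.1 else a l.1.
Definition letter2 a b l : R := if l.2 then a l.1 * b l.1 else 0.
Definition letter3 a b c l : R := if l.2 then - (a l.1 * b l.1 * c l.1) else 0.

Fixpoint mag1 a w : R := if w is l :: w' then letter1 a l + mag1 a w' else 0.

Fixpoint mag2 a b w : R :=
  if w is l :: w' then letter2 a b l + letter1 a l * mag1 b w' + mag2 a b w' else 0.

Fixpoint mag3 a b c w : R :=
  if w is l :: w' then
    letter3 a b c l + letter2 a b l * mag1 c w' + letter1 a l * mag2 b c w' + mag3 a b c w'
  else 0.

Lemma mag1_cat a u v : mag1 a (u ++ v) = mag1 a u + mag1 a v.
Proof. by elim: u => [|l u IH] /=; [ring | rewrite IH; ring]. Qed.

Lemma mag2_cat a b u v :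
  mag2 a b (u ++ v) = mag2 a b u + mag1 a u * mag1 b v + mag2 a b v.
Proof. by elim: u => [|l u IH] /=; [ring | rewrite IH mag1_cat; ring]. Qed.

Lemma mag3_cat a b c u v :
  mag3 a b c (u ++ v) =
  mag3 a b c u + mag2 a b u * mag1 c v + mag1 a u * mag2 b c v + mag3 a b c v.
Proof. by elim: u => [|l u IH] /=; [ring | rewrite IH mag1_cat mag2_cat; ring]. Qed.

Lemma mag1_winv a u : mag1 a (winv u) = - mag1 a u.
Proof.
elim: u => [|[x s] u IH]; first by rewrite /= oppr0.
by rewrite winv_cons mag1_cat IH /= /letter1 /=; case: s => /=; ring.
Qed.

Lemma mag2_winv a b u : mag2 a b (winv u) = mag1 a u * mag1 b u - mag2 a b u.
Proof.
elim: u => [|[x s] u IH]; first by rewrite /=; ring.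
by rewrite winv_cons mag2_cat IH mag1_winv /= /letter1 /letter2 /=; case: s => /=; ring.
Qed.

Lemma mag3_winv a b c u :
  mag3 a b c (winv u) = mag1 a u * mag2 b c u + mag2 a b u * mag1 c u
                        - mag1 a u * mag1 b u * mag1 c u - mag3 a b c u.
Proof.
elim: u => [|[x s] u IH]; first by rewrite /=; ring.
rewrite winv_cons mag3_cat IH mag1_winv mag2_winv /= /letter1 /letter2 /letter3 /=.
by case: s => /=; ring.
Qed.

Lemma mag_push a b c l s :
  [/\ mag1 a (push l s) = mag1 a (l :: s), mag2 a b (push l s) = mag2 a b (l :: s) &
      mag3 a b c (push l s) = mag3 a b c (l :: s)].
Proof.
case: l s => x t [|[y t'] s] //=; case: ifP => //= /andP[/eqP -> {y}].
by rewrite /letter1 /letter2 /letter3 /=; case: t t' => [] [] //= _; split; ring.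
Qed.

Lemma mag_reduce a b c u :
  [/\ mag1 a (reduce u) = mag1 a u, mag2 a b (reduce u) = mag2 a b u &
      mag3 a b c (reduce u) = mag3 a b c u].
Proof.
elim: u a b c => //= l u IH a b c.
have [-> -> ->] := mag_push a b c l (reduce u); rewrite /=.
by have [-> -> ->] := IH a b c; have [-> -> _] := IH b c c; have [-> _ _] := IH c c c.
Qed.

Lemma mag1_reduce a u : mag1 a (reduce u) = mag1 a u.
Proof. by have [] := mag_reduce a a a u. Qed.
Lemma mag2_reduce a b u : mag2 a b (reduce u) = mag2 a b u.
Proof. by have [] := mag_reduce a b b u. Qed.
Lemma mag3_reduce a b c u : mag3 a b c (reduce u) = mag3 a b c u.
Proof. by have [] := mag_reduce a b c u. Qed.

Lemma mag1_gen a x : mag1 a (gen x) = a x.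
Proof. by rewrite /= addr0. Qed.
Lemma mag2_gen a b x : mag2 a b (gen x) = 0.
Proof. by rewrite /= /letter2 /=; ring. Qed.
Lemma mag3_gen a b c x : mag3 a b c (gen x) = 0.
Proof. by rewrite /= /letter3 /letter2 /=; ring. Qed.

(** [pull1 e] is the action of [e] on H^1; the other two are the second and third order parts of [e]
    on generators, in dual form. *)
Definition pull1 e a : {ffun X -> R} := [ffun x => mag1 a (e x)].
Definition pull2 e a b : {ffun X -> R} := [ffun x => mag2 a b (e x)].
Definition pull3 e a b c : {ffun X -> R} := [ffun x => mag3 a b c (e x)].

Lemma mag1_ext e a u : mag1 a (ext e u) = mag1 (pull1 e a) u.
Proof.
rewrite /ext mag1_reduce; elim: u => [|[x s] u IH] //=; rewrite mag1_cat IH; congr (_ + _).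
by rewrite /letter1 /= ffunE; case: s => //=; rewrite mag1_winv.
Qed.

(** Chain rule: each variable is replaced by the expansion of its image. A term of degree two comes
    from two linear parts or from one quadratic part; [mag3_ext] collects degree three likewise. *)
Lemma mag2_ext e a b u :
  mag2 a b (ext e u) = mag2 (pull1 e a) (pull1 e b) u + mag1 (pull2 e a b) u.
Proof.
rewrite /ext mag2_reduce; elim: u => [|[x s] u IH] /=; first by ring.
have := mag1_ext e b u; rewrite /ext mag1_reduce mag2_cat IH => ->.
by rewrite /letter1 /letter2 /= !ffunE; case: s; rewrite ?mag1_winv ?mag2_winv; ring.
Qed.

Lemma mag3_ext e a b c u :
  mag3 a b c (ext e u) =
  mag3 (pull1 e a) (pull1 e b) (pull1 e c) u + mag2 (pull2 e a b) (pull1 e c) u +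
  mag2 (pull1 e a) (pull2 e b c) u + mag1 (pull3 e a b c) u.
Proof.
rewrite /ext mag3_reduce; elim: u => [|[x s] u IH] /=; first by ring.
have := mag1_ext e c u; have := mag2_ext e b c u.
rewrite /ext mag1_reduce mag2_reduce mag3_cat IH => -> ->.
rewrite /letter1 /letter2 /letter3 /= !ffunE.
by case: s; rewrite ?mag1_winv ?mag2_winv ?mag3_winv; ring.
Qed.

Lemma mag1D a b u : mag1 (a + b) u = mag1 a u + mag1 b u.
Proof.
by elim: u => [|[x s] u IH] /=; rewrite ?IH /letter1 /= ?ffunE; [ring | case: s; ring].
Qed.

Lemma mag2Dl a a' b u : mag2 (a + a') b u = mag2 a b u + mag2 a' b u.
Proof.
by elim: u => [|[x s] u IH] /=; rewrite ?IH /letter1 /letter2 /= ?ffunE; [ring | case: s; ring].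
Qed.

Lemma mag2Dr a b b' u : mag2 a (b + b') u = mag2 a b u + mag2 a b' u.
Proof.
elim: u => [|[x s] u IH] /=; rewrite ?IH /letter1 /letter2 /= ?ffunE; first by ring.
by rewrite mag1D; case: s; ring.
Qed.

(* Quasi-shuffle relation: 1 + X is not exponential. *)
Lemma mag2_shuffle a b u :
  mag2 a b u + mag2 b a u + mag1 [ffun x => a x * b x] u = mag1 a u * mag1 b u.
Proof.
elim: u => [|[x s] u IH] /=; first by ring.
move: IH; set m := mag1 _ u => IH; rewrite /letter1 /letter2 /= ffunE.
have -> : m = mag1 a u * mag1 b u - mag2 a b u - mag2 b a u by rewrite -IH; ring.
by case: s; ring.
Qed.

Lemma mag1_conj a w u : mag1 a (w ++ u ++ winv w) = mag1 a u.
Proof. by rewrite !mag1_cat mag1_winv; ring. Qed.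

Lemma mag2_conj a b w u :
  mag2 a b (w ++ u ++ winv w) = mag2 a b u + mag1 a w * mag1 b u - mag1 a u * mag1 b w.
Proof. by rewrite !(mag2_cat, mag1_cat) mag1_winv mag2_winv; ring. Qed.

Lemma mag3_conj a b c w u : (forall d, mag1 d w = 0) ->
  mag3 a b c (w ++ u ++ winv w) =
  mag3 a b c u + mag2 a b w * mag1 c u - mag1 a u * mag2 b c w.
Proof.
move=> w0; rewrite !(mag3_cat, mag2_cat, mag1_cat) mag1_winv mag2_winv mag3_winv !w0; ring.
Qed.

(** * Magnus coefficients modulo a relator in the commutator subgroup *)

Section Relator.
Variable r : word X.
Hypothesis r0 : forall a, mag1 a r = 0.

(** As [r] has no linear part, a conjugate of [r] by [g] has quadratic part [r_2] and cubic part
    [r_3 + [g_1, r_2]]. Thus [k] is the signed number of conjugates and [t] the signed sum of the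
    linear parts of the conjugators. *)
Lemma mag_in_ncl w : in_ncl r w ->
  exists (k : R) (t : {ffun X -> R} -> R),
   [/\ forall a, mag1 a w = 0,
       forall a b, mag2 a b w = k * mag2 a b r &
       forall a b c, mag3 a b c w =
         k * mag3 a b c r + t a * mag2 b c r - mag2 a b r * t c].
Proof.
case=> l wl; suff : exists (k : R) (t : {ffun X -> R} -> R),
   [/\ forall a, mag1 a (relators r l) = 0,
       forall a b, mag2 a b (relators r l) = k * mag2 a b r &
       forall a b c, mag3 a b c (relators r l) =
         k * mag3 a b c r + t a * mag2 b c r - mag2 a b r * t c].
  case=> k [t [h1 h2 h3]]; exists k, t; split=> [a|a b|a b c].
  - by rewrite -mag1_reduce wl mag1_reduce h1.
  - by rewrite -mag2_reduce wl mag2_reduce h2.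
  - by rewrite -mag3_reduce wl mag3_reduce h3.
elim: l {wl} => [|[g s] l [k [t [h1 h2 h3]]]].
  by exists 0, (fun=> 0); split=> *; rewrite /=; ring.
have h0 a : mag1 a (if s then winv r else r) = 0.
  by case: s; rewrite ?mag1_winv r0 ?oppr0.
exists ((if s then -1 else 1) + k), (fun a => (if s then -1 else 1) * mag1 a g + t a).
rewrite /relators /= -/(relators _ _); split=> [a|a b|a b c].
- by rewrite mag1_cat mag1_conj h0 h1 addr0.
- rewrite mag2_cat mag2_conj !mag1_conj !h0 !h1 h2.
  by case: s {h0}; rewrite ?mag2_winv ?r0; ring.
- rewrite mag3_cat !mag1_conj !h0 !h1 h3.
  rewrite !(mag3_cat, mag2_cat, mag1_cat) !h0 mag1_winv mag2_winv mag3_winv.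
  by case: s {h0}; rewrite ?mag3_winv ?mag2_winv ?r0; ring.
Qed.

Lemma mag1_eqr a u v : eqr r u v -> mag1 a u = mag1 a v.
Proof.
case/mag_in_ncl=> k [t [/(_ a)+ _ _]]; rewrite mag1_cat mag1_winv => /eqP.
by rewrite subr_eq0 => /eqP.
Qed.

Lemma mag2_eqr u v : eqr r u v ->
  exists k : R, forall a b, mag2 a b u = mag2 a b v + k * mag2 a b r.
Proof.
move=> uv; have uv1 a := mag1_eqr a uv.
case/mag_in_ncl: uv => k [t [_ h2 _]]; exists k => a b; rewrite -h2.
by rewrite mag2_cat mag1_winv mag2_winv !uv1; ring.
Qed.

(* When the second order terms agree, only the multiples of the relator of total
   multiplicity zero contribute. *)
Lemma mag3_eqr u v : eqr r u v ->
  (r = [::] \/ exists a b, mag2 a b r = 1) ->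
  (forall a b, mag2 a b u = mag2 a b v) ->
  exists t : {ffun X -> R} -> R, forall a b c, mag3 a b c u =
    mag3 a b c v + t a * mag2 b c r - mag2 a b r * t c.
Proof.
move=> uv rP uv2; have uv1 a := mag1_eqr a uv.
case/mag_in_ncl: uv => k [t [_ h2 h3]]; exists t => a b c.
have k3 : k * mag3 a b c r = 0.
  case: rP => [->|[a' [b' ab]]]; first by rewrite /= mulr0.
  suff -> : k = 0 by rewrite mul0r.
  rewrite -[k]mulr1 -ab -h2 mag2_cat mag1_winv mag2_winv uv2 !uv1; ring.
have := h3 a b c; rewrite k3 mag3_cat mag1_winv mag2_winv mag3_winv !uv2 !uv1 => h.
by rewrite -addrA; apply/eqP; rewrite addrC -subr_eq; apply/eqP; rewrite add0r in h;
  rewrite -h; ring.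
Qed.

(** The quadratic parts of [z x] and [x z] differ by the commutator of the linear parts, and the
    relator contributes nothing on the pair [a], [b]. *)
Lemma mag1_central a b x z : eqr r (z ++ gen x) (gen x ++ z) -> mag2 a b r = 0 ->
  mag1 a z * b x = a x * mag1 b z.
Proof.
move=> /mag2_eqr [k /(_ a b)] + ab; rewrite ab !mag2_cat mag2_gen !mag1_gen => h.
by apply/eqP; rewrite -subr_eq0; apply/eqP; move/eqP: h; rewrite -subr_eq0 => /eqP <-; ring.
Qed.

End Relator.
End Magnus.

Definition coordf (R : comNzRingType) (X : finType) (i : X) : {ffun X -> R} :=
  [ffun x => (x == i)%:R].
Arguments coordf : clear implicits.

Lemma feqP (X : eqType) (e f : endo X) : feq e f <-> forall x, eqr [::] (e x) (f x).
Proof. by split=> h x; apply/eqr_nil. Qed.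

Lemma inner_free_pull1 (R : comNzRingType) (X : finType) (e : endo X) (a : {ffun X -> R}) :
  inner_free e -> pull1 e a = a.
Proof.
case=> w /feqP ew; apply/ffunP=> x; rewrite ffunE (mag1_eqr _ a (ew x)) //.
by rewrite mag1_conj mag1_gen.
Qed.

(** * Outer automorphisms of order six *)

(** The field F_2 is [bool], so identities between finitely many coefficients can be decided by
    cases. *)
Lemma bool_ringE :
  ((forall x y : bool, (x + y)%R = addb x y) * (forall x y : bool, (x * y)%R = andb x y) *
   (forall x : bool, (- x)%R = x) * (0%R = false :> bool) * (1%R = true :> bool))%type.
Proof. by repeat split. Qed.

Ltac boolean :=
  rewrite ?bool_ringE;
  repeat match goal with
  | |- context [fun_of_fin ?f ?x] => case: (fun_of_fin f x); rewrite ?bool_ringE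
  | |- context [mag1 ?a ?u] => case: (mag1 a u); rewrite ?bool_ringE
  | |- context [mag2 ?a ?b ?u] => case: (mag2 a b u); rewrite ?bool_ringE
  | |- context [mag3 ?a ?b ?c ?u] => case: (mag3 a b c u); rewrite ?bool_ringE
  | |- context [?x == ?y] => case: (x == y); rewrite ?bool_ringE
  end; by [].

Section OrderSix.
Variables (X : finType) (i0 i1 i2 : X) (r : word X) (phi : endo X) (w : word X).
Local Notation V := {ffun X -> bool}.
Local Notation e := (coordf bool X i0).
Local Notation f := (coordf bool X i1).
Local Notation S := (pull1 phi : V -> V).
Local Notation alpha := (epow phi 3).
Implicit Types (a b c z : V).

Definition off01 z := (z i0 = 0) /\ (z i1 = 0).

(* omf is the intersection form mod 2 (zero in the free case); prd is dual to the degree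
   one part of phi^3 - 1, and qf is the second order part of w. *)
Definition omf a b : bool := mag2 a b r.
Definition qf a b : bool := mag2 a b w.
Definition prd a b : V := pull2 alpha a b.
Definition sc (k : bool) a : V := if k then a else 0.

Hypotheses (i01 : i0 != i1) (i02 : i0 != i2) (i12 : i1 != i2).
(** On forms, [S] is the transpose of A mod 2; it permutes [e], [f], [e + f] cyclically. These
    hypotheses and the squares below are verified in [rot6_pull1] and [rot6_mul]. *)
Hypotheses (Se : S e = f) (Sf : S f = e + f) (Sz : forall z, off01 z -> S z = z).
Hypotheses (mul_ee : prd e e = e) (mul_ff : prd f f = f)
           (mul_zz : forall z, off01 z -> prd z z = 0).
Hypotheses (r0 : forall a, mag1 a r = 0) (rP : r = [::] \/ exists a b, mag2 a b r = 1).
Hypotheses (om_aa : forall a, omf a a = 0)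
           (om_ez : forall z, off01 z -> omf e z = 0) (om_fz : forall z, off01 z -> omf f z = 0).
Hypothesis stable : ext_stable r phi.
Hypothesis phi6 : forall x, eqr r (epow phi 6 x) (w ++ gen x ++ winv w).

Lemma addvv a : a + a = 0.
Proof. by apply/ffunP=> x; rewrite !ffunE; boolean. Qed.

Lemma addvK a b : a + b + b = a.
Proof. by rewrite -addrA addvv addr0. Qed.

Lemma addv_eq0 a b : a + b = 0 -> a = b.
Proof. by move=> h; rewrite -[a](addvK a b) h add0r. Qed.

Lemma decomp a : exists2 z, off01 z & [\/ a = z, a = e + z, a = f + z | a = e + f + z].
Proof.
exists [ffun x => if (x == i0) || (x == i1) then 0 else a x].
  by rewrite /off01 !ffunE !eqxx orbT.
have E k l : a i0 = k -> a i1 = l ->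
    a = sc k e + sc l f + [ffun x => if (x == i0) || (x == i1) then 0 else a x].
  move=> a0 a1; apply/ffunP=> x; rewrite !ffunE /sc.
  case: (eqVneq x i0) => [->|x0] /=; rewrite ?a0.
    by case: k {a0} l {a1} => [] []; rewrite !ffunE ?eqxx ?(negPf i01).
  case: (eqVneq x i1) => [->|x1] /=; rewrite ?a1.
    by case: k {a0} l {a1} => [] []; rewrite !ffunE ?eqxx ?(eq_sym i1) ?(negPf i01).
  by case: k {a0} l {a1} => [] []; rewrite !ffunE ?(negPf x0) ?(negPf x1) ?bool_ringE.
case a0: (a i0); case a1: (a i1); have := E _ _ a0 a1; rewrite /sc ?add0r ?addr0 => <-.
- by apply: Or44.
- by apply: Or42.
- by apply: Or43.
- by apply: Or41.
Qed.

Lemma off01D z z' : off01 z -> off01 z' -> off01 (z + z').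
Proof. by move=> [h1 h2] [h3 h4]; rewrite /off01 !ffunE h1 h2 h3 h4. Qed.

Lemma SD a b : S (a + b) = S a + S b.
Proof. by apply/ffunP=> x; rewrite !ffunE mag1D. Qed.

Lemma mag_eqr0 u v a b : eqr [::] u v -> mag1 a u = mag1 a v /\ mag2 a b u = mag2 a b v.
Proof.
move=> /eqr_nil uv; rewrite -(mag1_reduce a u) -(mag2_reduce a b u) uv.
by rewrite mag1_reduce mag2_reduce.
Qed.

Lemma pull1_alpha a : pull1 alpha a = a.
Proof.
have E b : pull1 alpha b = S (S (S b)).
  apply/ffunP=> x; rewrite ffunE epowS mag1_ext epowS mag1_ext epowS mag1_ext.
  by rewrite /epow /= /letter1 /= addr0.
rewrite {}E; have [z zZ h] := decomp a.
by case: h => ->; rewrite !(SD, Se, Sf, Sz zZ) //; apply/ffunP=> x; rewrite !ffunE; boolean.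
Qed.

Lemma mulE a b x : prd a b x = mag2 a b (alpha x).
Proof. by rewrite ffunE. Qed.

Lemma mag1_alpha_gen a x : mag1 a (alpha x) = a x.
Proof. by rewrite -[RHS](congr1 (fun b : V => b x) (pull1_alpha a)) ffunE. Qed.

(** Quasi-shuffle relation at [alpha x]: as [alpha] acts trivially on V, the product of the values
    of [a] and [b] cancels the value of their pointwise product. *)
Lemma mulC a b : prd a b = prd b a.
Proof.
apply: addv_eq0; apply/ffunP=> x; rewrite !ffunE.
have := mag2_shuffle a b (alpha x); rewrite !mag1_alpha_gen ffunE.
by boolean.
Qed.

Lemma mulDl a b c : prd (a + b) c = prd a c + prd b c.
Proof. by apply/ffunP=> x; rewrite !ffunE mag2Dl. Qed.

Lemma mulDr a b c : prd a (b + c) = prd a b + prd a c.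
Proof. by rewrite !(mulC a) mulDl. Qed.

Lemma mul0v a : prd 0 a = 0.
Proof. by have := mulDl 0 0 a; rewrite addr0 addvv. Qed.

Lemma mulv0 a : prd a 0 = 0.
Proof. by rewrite mulC mul0v. Qed.

(** Second order terms of the identity [alpha phi = phi alpha]. *)
Lemma S_mul a b : S (prd a b) = prd (S a) (S b).
Proof.
apply/ffunP=> x; rewrite !ffunE.
have comm : eqr [::] (ext alpha (phi x)) (ext phi (alpha x)).
  by rewrite -(ext_gen [::] phi x) -ext_epowSr ext_gen.
have [_] := mag_eqr0 a b comm; rewrite !mag2_ext !pull1_alpha mag1_alpha_gen ffunE.
by rewrite [RHS]addrC => /addrI.
Qed.

Lemma alpha_alpha x : eqr r (ext alpha (alpha x)) (w ++ gen x ++ winv w).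
Proof.
rewrite -phi6; apply: eqr0_eqr; rewrite -[X in eqr _ _ X](ext_gen [::]).
by rewrite (ext_epowD phi 3 3) [in X in eqr _ _ X]ext_gen.
Qed.

Lemma mag2_alpha_alpha a b x : mag2 a b (ext alpha (alpha x)) = 0.
Proof.
rewrite mag2_ext !pull1_alpha mag1_alpha_gen -/(prd a b) mulE.
by case: (mag2 _ _ _).
Qed.

(** The quadratic part of [alpha^2] is twice that of [alpha], hence zero, so [[w_1, x]] is a
    multiple of the intersection form. Testing on orthogonal pairs taken from the plane and Z gives
    [w_1 = 0]. *)
Lemma w0 a : mag1 a w = 0.
Proof.
have key b c x : omf b c = 0 -> mag1 b w * c x = b x * mag1 c w.
  move=> bc; have [k /(_ b c)] := mag2_eqr r0 (alpha_alpha x).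
  rewrite mag2_alpha_alpha -/(omf b c) bc mag2_conj mag2_gen !mag1_gen.
  by rewrite mulr0; boolean.
have off2 : off01 (coordf bool X i2).
  by rewrite /off01 !ffunE (negPf i02) (negPf i12).
have we : mag1 e w = 0.
  by have := key e (coordf bool X i2) i2 (om_ez off2);
    rewrite !ffunE eqxx eq_sym (negPf i02) mulr1 mul0r.
have wf : mag1 f w = 0.
  by have := key f (coordf bool X i2) i2 (om_fz off2);
    rewrite !ffunE eqxx eq_sym (negPf i12) mulr1 mul0r.
have wz z : off01 z -> mag1 z w = 0.
  move=> zZ; have := key e z i0 (om_ez zZ); rewrite we !ffunE eqxx mul0r mul1r => <- //.
have [z zZ h] := decomp a.
by case: h => ->; rewrite !(mag1D, we, wf, wz z zZ) ?addr0.
Qed.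

(** Third order terms of [alpha_alpha]: the cubic part of [alpha] occurs twice and cancels, and [L]
    collects the relator contributions over all generators. *)
Lemma assoc : exists L : V -> V, forall a b c,
  prd (prd a b) c + prd a (prd b c) =
  sc (qf a b) c + sc (qf b c) a + sc (omf a b) (L c) + sc (omf b c) (L a).
Proof.
have H x : exists t : V -> bool, forall a b c,
    prd (prd a b) c x + prd a (prd b c) x =
    qf a b * c x + qf b c * a x + omf a b * t c + omf b c * t a.
  have [|t ht] := mag3_eqr r0 (alpha_alpha x) rP.
    by move=> a b; rewrite mag2_alpha_alpha mag2_conj !w0 mag2_gen; boolean.
  exists t => a b c; have := ht a b c.
  rewrite mag3_conj; last exact: w0.
  rewrite mag3_ext !pull1_alpha mag3_gen !mag1_gen mag1_alpha_gen -!/(prd _ _) ffunE.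
  rewrite -!mulE -/(qf a b) -/(qf b c) -/(omf a b) -/(omf b c).
  by case: (mag3 _ _ _ _) (qf a b) (qf b c) (omf a b) (omf b c) (t a) (t c) => [] [] [] [] [] [] [];
    boolean.
have [t ht] := fin_all_exists H; exists (fun a => [ffun x => t x a]) => a b c.
apply/ffunP=> x; rewrite !ffunE -!mulE ht.
by case: (qf a b) (qf b c) (omf a b) (omf b c) => [] [] [] []; rewrite /sc !ffunE; boolean.
Qed.

Lemma qC a b : qf a b = qf b a.
Proof.
have := mag2_shuffle a b w; rewrite !w0 -/(qf a b) -/(qf b a).
by case: (qf a b) (qf b a) => [] [].
Qed.

Lemma qDl a b c : qf (a + b) c = qf a c + qf b c.
Proof. exact: mag2Dl. Qed.

Lemma omC a b : omf a b = omf b a.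
Proof.
have := mag2_shuffle a b r; rewrite !r0 -/(omf a b) -/(omf b a).
by case: (omf a b) (omf b a) => [] [].
Qed.

Lemma omDr a b c : omf a (b + c) = omf a b + omf a c.
Proof. exact: mag2Dr. Qed.

(** As [phi] commutes with [phi^6], conjugation by [phi(w)] and by [w] agree on [phi x]; third order
    terms are compared on forms for which the relator contributes nothing. *)
Lemma q_S a b c : omf a b = 0 -> omf b c = 0 ->
  sc (qf (S a) (S b) + qf a b) (S c) + sc (qf (S b) (S c) + qf b c) (S a) = 0.
Proof.
move=> ab bc; apply/ffunP=> x.
have pw0 (d : V) : mag1 d (ext phi w) = 0 by rewrite mag1_ext w0.
have pwq (d d' : V) : mag2 d d' (ext phi w) = qf (S d) (S d') by rewrite mag2_ext w0 addr0.
have comm : eqr r (ext phi w ++ phi x ++ winv (ext phi w)) (w ++ phi x ++ winv w).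
  apply: (@eqr_trans _ _ (ext phi (w ++ gen x ++ winv w))).
    by rewrite !ext_cat ext_winv ext_gen.
  apply: (@eqr_trans _ _ (ext phi (epow phi 6 x))).
    by apply: ext_eqr => //; apply: eqr_sym.
  rewrite -(ext_epow_inner phi6 (phi x)); apply: eqr0_eqr.
  by rewrite -(ext_gen [::] phi x) -ext_epowSr ext_gen.
have [|t /(_ a b c)] := mag3_eqr r0 comm rP.
  by move=> d d'; rewrite !mag2_conj !w0 !pw0; boolean.
rewrite !mag3_conj //; last exact: w0.
rewrite !pwq -/(omf a b) -/(omf b c) ab bc -/(qf a b) -/(qf b c).
have Sx (d : V) : mag1 d (phi x) = S d x by rewrite ffunE.
rewrite !Sx mulr0 mul0r subr0 addr0 [X in _ -> X = _]ffunE.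
case: (qf (S a) (S b)) (qf (S b) (S c)) (qf a b) (qf b c) => [] [] [] [];
  rewrite /sc /= ?bool_ringE; move: (S a) (S c) (mag3 _ _ _ _) => sa sd m3;
  by rewrite !ffunE; case: m3; boolean.
Qed.

Local Notation e2 := (coordf bool X i2).

Lemma off01_e2 : off01 e2.
Proof. by rewrite /off01 !ffunE (negPf i02) (negPf i12). Qed.

Lemma ee0 : e i0 = 1. Proof. by rewrite ffunE eqxx. Qed.
Lemma ff0 : f i0 = 0. Proof. by rewrite ffunE (negPf i01). Qed.
Lemma ff1 : f i1 = 1. Proof. by rewrite ffunE eqxx. Qed.

Lemma sc_at (k : bool) a x : sc k a x = k * a x.
Proof. by case: k; rewrite /sc ?ffunE ?mul1r ?mul0r. Qed.

(** By [q_S], [q(-, z)] is an [S]-invariant linear form on the plane. It takes one value on [e], [f]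
    and [e + f], which is therefore 0. *)
Lemma q_ez z : off01 z -> qf e z = 0 /\ qf f z = 0.
Proof.
move=> zZ; have [z0 z1] := zZ.
have /ffunP/(_ i1) := q_S (om_aa e) (om_ez zZ).
have /ffunP/(_ i0) := q_S (om_aa f) (om_fz zZ).
rewrite !Se !Sf (Sz zZ) !qDl !ffunE !sc_at z0 z1 ff1 !ffunE !eqxx (negPf i01) !mulr0 !add0r.
by case: (qf e z) (qf f z) => [] []; rewrite !bool_ringE.
Qed.

(** The same argument for the additive map sending [b] to [q(b, b)], tested against a third
    coordinate. *)
Lemma q_ee : qf e e = 0 /\ qf f f = 0.
Proof.
have [q1 q2] := q_ez off01_e2; have [z0 z1] := off01_e2.
have /ffunP/(_ i2) := q_S (om_aa e) (om_ez off01_e2).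
have /ffunP/(_ i2) := q_S (om_aa f) (om_fz off01_e2).
have qDr a b c : qf a (b + c) = qf a b + qf a c by rewrite !(qC a) qDl.
rewrite !Se !Sf (Sz off01_e2) !(qDl, qDr) q1 q2 (qC f e).
rewrite !ffunE !sc_at !ffunE eqxx.
by case: (qf e f) (qf e e) (qf f f) => [] [] []; rewrite !bool_ringE.
Qed.

Lemma mul_e_z z : off01 z -> prd e z = sc (qf z z) e /\ prd f z = sc (qf z z) f.
Proof.
move=> zZ; have [L assocL] := assoc.
have [[qee qff] [qez qfz]] := (q_ee, q_ez zZ).
have AIe := assocL e e z; have AIf := assocL f f z.
rewrite mul_ee qee qez om_aa (om_ez zZ) /sc !addr0 in AIe.
rewrite mul_ff qff qfz om_aa (om_fz zZ) /sc !addr0 in AIf.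
have {}AIe := addv_eq0 AIe; have {}AIf := addv_eq0 AIf.
have Sez : prd f z = S (prd e z) by rewrite S_mul Se Sz.
have SSez : S (S (prd e z)) = prd e z + S (prd e z).
  by rewrite -Sez S_mul Sf Sz // mulDl.
(* The associator of [z], [z], [e] gives [k^2 = q(z, z)]. *)
suff [k [ek fk]] : exists k, prd e z = sc k e /\ prd f z = sc k f.
  suff -> : qf z z = k by [].
  have := assocL z z e; rewrite mul_zz // mul0v add0r om_aa (omC z) om_ez // (qC z e) qez.
  rewrite ![prd z _]mulC ek; have -> : prd (sc k e) z = sc k (prd e z).
    by rewrite /sc; case: k {ek fk}; rewrite ?mul0v.
  rewrite ek /sc !addr0 => /ffunP/(_ i0); case: k (qf z z) {ek fk} => [] [] //;
    rewrite ee0 ffunE //.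
have [z' z'Z h] := decomp (prd e z).
(* On Z, where [S] is the identity, [S^2 p = p + S p] forces [p = 0]. *)
have z'0 : z' = 0.
  move: SSez; case: h => ->; rewrite !(SD, Se, Sf, Sz z'Z) => /eqP; rewrite -subr_eq0 => /eqP h;
  apply/ffunP=> x; move/ffunP/(_ x): h; by rewrite !ffunE; boolean.
(* If [e z] is [f] or [e + f], then [AIe] and [AIf] give both [e f = f] and [e f = e]. *)
have ef_contra : prd e f = e -> prd e f = f -> False.
  by move=> -> /ffunP/(_ i0); rewrite ee0 ff0.
case: h => h; rewrite z'0 ?addr0 in h; rewrite Sez h ?(SD, Se, Sf) in AIe AIf *.
- by exists false; rewrite /sc; split=> //; rewrite Sz // /off01 !ffunE.
- by exists true.
- case: ef_contra; last by rewrite -AIe.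
  move: AIf; rewrite mulDr mul_ff mulC => /ffunP h'; apply/ffunP=> x; have := h' x.
  by rewrite !ffunE -!mulE; boolean.
- case: ef_contra; last first.
    move: AIe; rewrite mulDr mul_ee => /ffunP h'; apply/ffunP=> x; have := h' x.
    by rewrite !ffunE -!mulE; boolean.
  move: AIf; rewrite mulC !mulDl mul_ff => /ffunP h'; apply/ffunP=> x; have := h' x.
  by rewrite !ffunE -!mulE; boolean.
Qed.

Lemma S_eq_addf k : S k = k + f -> exists2 z, off01 z & k = e + f + z.
Proof.
have [z zZ h] := decomp k; case: h => ->; rewrite !(SD, Se, Sf, Sz zZ).
- by move=> /ffunP/(_ i1); rewrite !ffunE !eqxx; boolean.
- by move=> /ffunP/(_ i0); rewrite !ffunE !eqxx (negPf i01); boolean.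
- by move=> /ffunP/(_ i0); rewrite !ffunE !eqxx (negPf i01); boolean.
- by exists z.
Qed.

Lemma S_mul_ef : S (prd e f) = prd e f + f.
Proof. by rewrite S_mul Se Sf mulDr mul_ff mulC. Qed.

Lemma mul_sc_r (k : bool) a b : prd a (sc k b) = sc k (prd a b).
Proof. by case: k; rewrite /sc ?mulv0. Qed.

Lemma order_six_free : r <> [::].
Proof.
move=> rnil; have om0 a b : omf a b = 0 by rewrite /omf rnil.
have [[L assocL] [qee qff]] := (assoc, q_ee).
have AI a b c : prd (prd a b) c + prd a (prd b c) = sc (qf a b) c + sc (qf b c) a.
  by rewrite assocL !om0 /sc !addr0.
have [z1 z1Z ef] := S_eq_addf S_mul_ef.
(* Associator of [e], [e], [f]. *)
have qef : qf e f = 1 + qf z1 z1.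
  have := AI e e f; rewrite mul_ee qee {2}ef !mulDr mul_ee ef (mul_e_z z1Z).1.
  move/ffunP/(_ i0); rewrite !ffunE !sc_at !ffunE !eqxx (negPf i01) z1Z.1.
  by case: (qf e f) (qf z1 z1) => [] []; rewrite !bool_ringE.
(* Associator of [e], [f], [z]. Taking [z = z1] gives [z1 = 0]; then a nonzero [z] is
   contradictory. *)
have key z : off01 z -> prd z1 z + sc (qf z z) z1 = sc (1 + qf z1 z1) z.
  move=> zZ; have [ez fz] := mul_e_z zZ; have := AI e f z.
  rewrite (q_ez zZ).2 fz mul_sc_r ef !mulDl ez fz qef => /ffunP h.
  apply/ffunP=> x; have := h x; rewrite !ffunE !sc_at -!mulE !ffunE.
  by case: (qf z z) (qf z1 z1) => [] []; boolean.
have z10 : z1 = 0.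
  have := key z1 z1Z; rewrite mul_zz // add0r.
  by rewrite /sc; case: (qf z1 z1) => /= ->.
have q00 : qf 0 0 = 0 by have := qDl 0 0 0; rewrite addr0; case: (qf 0 0).
have /ffunP/(_ i2) := key e2 off01_e2.
by rewrite z10 q00 mul0v !ffunE !sc_at !ffunE eqxx; case: (qf _ _).
Qed.

(** Third order terms of [alpha(r)], which lies in the normal closure of [r]; comparing second order
    terms gives it multiplicity one. *)
Lemma om_mul : (exists a b, omf a b = 1) -> exists u : V -> bool, forall a b c,
  omf (prd a b) c + omf a (prd b c) = u a * omf b c + omf a b * u c.
Proof.
move=> [a0 [b0 ab0]]; have [k [u [_ h2 h3]]] := mag_in_ncl r0 (ext_stable_epow stable 3).
have k1 : k = 1.
  by have := h2 a0 b0; rewrite mag2_ext !pull1_alpha r0 -/(omf a0 b0) ab0 addr0 mulr1.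
exists u => a b c; have := h3 a b c.
rewrite k1 mag3_ext !pull1_alpha r0 -!/(prd _ _) -!/(omf _ _) mul1r addr0.
by case: (mag3 _ _ _ _) (omf (prd a b) c) (omf a (prd b c)) (u a * omf b c) (omf a b * u c)
  => [] [] [] [] [].
Qed.

Lemma om0v a : omf 0 a = 0.
Proof. by rewrite omC; have := omDr a 0 0; rewrite addr0; case: (omf a 0). Qed.

Lemma q_nondegenerate a c : omf e f = 1 -> off01 a -> off01 c -> omf a c = 1 -> qf a a <> 0.
Proof.
move=> omef aZ cZ omac qaa; have a0 : a <> 0 by move=> a0; move: omac; rewrite a0 om0v.
have [[L AI] [qee qff]] := (assoc, q_ee).
have [|u omu] := om_mul; first by exists e, f.
have [qea qfa] := q_ez aZ; have [ea fa] := mul_e_z aZ; rewrite qaa /sc in ea fa.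
(* In the associators below, [a c] and [e f] produce the same unknown term of [L], so only their sum
   is used; it satisfies the equation of [S_eq_addf] because [S] fixes [a c]. *)
have [k0 kE] : exists2 t, off01 t & prd a c + prd e f = e + f + t.
  by apply: S_eq_addf; rewrite SD S_mul_ef S_mul !Sz // addrA.
move: k0 kE => t tZ kE; have [et ft] := mul_e_z tZ.
have qt : 1 + qf t t = qf a c + qf e f.
  have h1 := AI e a c; have h2 := AI e e f.
  rewrite ea mul0v add0r qea om_ez // omac /sc add0r addr0 in h1.
  rewrite mul_ee qee om_aa omef /sc add0r addr0 in h2.
  have : prd e f + prd e (prd a c + prd e f) = sc (qf a c) e + sc (qf e f) e.
    rewrite mulDr h1; apply/ffunP=> x; move/ffunP/(_ x): h2; rewrite !ffunE -!mulE.
    by rewrite !sc_at /=; case: (qf a c) (qf e f) => [] [] /=; boolean.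
  rewrite kE !mulDr mul_ee et => /ffunP/(_ i0); rewrite !ffunE !sc_at !ffunE eqxx.
  by case: (qf t t) (qf a c) (qf e f) => [] [] []; boolean.
have at_a : prd a t = sc (1 + qf t t) a.
  have h1 := AI a a c; have h2 := AI a e f.
  rewrite mul_zz // mul0v add0r qaa om_aa omac /sc add0r addr0 in h1.
  rewrite [prd a e]mulC ea mul0v add0r [qf a e]qC qea [omf a e]omC om_ez // omef /sc add0r addr0 in h2.
  have : prd a (prd a c + prd e f) = sc (1 + qf t t) a.
    rewrite mulDr h1 h2 qt; apply/ffunP=> x; rewrite !ffunE sc_at.
    by case: (qf a c) (qf e f) => [] []; rewrite ?ffunE; boolean.
  by rewrite kE !mulDr [prd a e]mulC [prd a f]mulC ea fa !add0r.
have omat : omf a t = 0.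
  have h1 := omu a a c; have h2 := omu a e f.
  rewrite mul_zz // om_aa omac in h1.
  rewrite [prd a e]mulC ea [omf a e]omC (om_ez aZ) omef in h2.
  have : omf a (prd a c + prd e f) = 0.
    move: h1 h2; rewrite omDr !om0v.
    by case: (omf a (prd a c)) (omf a (prd e f)) (u a) => [] [] [].
  by rewrite kE !omDr [omf a e]omC [omf a f]omC om_ez // om_fz // !add0r.
(* Associator of [t], [t], [a]. Hence [t = a], and [a a = 0] contradicts [at_a]. *)
have ta : a = sc (qf t a) t.
  have := AI t t a; rewrite mul_zz // mul0v add0r om_aa [omf t a]omC omat /sc !addr0.
  rewrite -/(sc _ _) -/(sc _ _) [prd t a]mulC at_a mul_sc_r [prd t a]mulC at_a => /ffunP h.
  apply/ffunP=> x; have := h x; rewrite !ffunE !sc_at.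
  by case: (qf t t) (qf t a) => [] []; boolean.
have ta' : t = a by move: ta; rewrite /sc; case: (qf t a) => // /a0.
apply: a0; move: at_a; rewrite ta' mul_zz // qaa => /ffunP h.
by apply/ffunP=> x; have := h x; rewrite sc_at !ffunE; boolean.
Qed.

(* The squaring map of qf is additive, hence vanishes somewhere on the plane spanned by a, c. *)
Lemma order_six_surface a c : omf e f = 1 -> off01 a -> off01 c -> omf a c = 1 -> False.
Proof.
move=> omef aZ cZ omac; have acZ := off01D aZ cZ.
have := q_nondegenerate omef aZ cZ omac.
have : qf c c <> 0 by apply: (q_nondegenerate omef cZ aZ); rewrite omC.
have : qf (a + c) (a + c) <> 0.
  by apply: (q_nondegenerate omef acZ cZ); rewrite omC omDr om_aa addr0 omC.
rewrite qDl ![qf _ (a + c)]qC !qDl [qf c a]qC.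
by case: (qf a a) (qf a c) (qf c c) => [] [] [].
Qed.

End OrderSix.

(** * The matrix of order six and the squares of its lifts *)

Lemma expsum_cons (X : eqType) (i : X) l (u : word X) :
  expsum i (l :: u) = (if l.1 == i then (if l.2 then -1 else 1) else 0) + expsum i u.
Proof.
rewrite /expsum /=; case: l => x s /=; rewrite !xpair_eqE.
by case: (x == i); case: s => /=; lia.
Qed.

Lemma mag1_expsum (R : comNzRingType) (X : finType) (a : {ffun X -> R}) (u : word X) :
  mag1 a u = \sum_i a i * (expsum i u)%:~R.
Proof.
elim: u => [|[x s] u IH].
  by rewrite big1 // => i _; rewrite /expsum /= subrr mulr0.
rewrite /= IH [RHS](eq_bigr (fun i => a i * (if x == i then (if s then -1 else 1) else 0) +
  a i * (expsum i u)%:~R)); last first.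
  by move=> i _; rewrite expsum_cons intrD mulrDr /=; case: (x == i); case: s.
rewrite big_split /=; congr (_ + _); rewrite (bigD1 x) //= eqxx big1 ?addr0 => [|i].
  by rewrite /letter1 /=; case: s; rewrite ?mulrN1 ?mulr1.
by rewrite eq_sym => /negPf ->; rewrite mulr0.
Qed.

Section Block.
Variables (N : nat) (i0 i1 : 'I_N).
Hypotheses (i0E : i0 = 0 :> nat) (i1E : i1 = 1 :> nat).

Definition block2 (p q s t : int) : 'M[int]_N := \matrix_(i, j)
  match i : nat, j : nat with
  | 0%N, 0%N => p | 0%N, 1%N => q | 1%N, 0%N => s | 1%N, 1%N => t | _, _ => (i == j)%:R
  end.

Lemma sum_block2 (R : comNzRingType) p q s t (v : 'I_N -> R) (j : 'I_N) :
  \sum_l v l * (block2 p q s t l j)%:~R =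
  match j : nat with
  | 0%N => v i0 * p%:~R + v i1 * s%:~R | 1%N => v i0 * q%:~R + v i1 * t%:~R | _ => v j
  end.
Proof.
have i01 : i0 != i1 by apply/eqP=> /(congr1 val) /=; rewrite i0E i1E.
case: (ltnP j 2) => [j2|j2].
  rewrite (bigD1 i0) //= (bigD1 i1) 1?eq_sym //= big1 => [|l /andP[l0 l1]]; last first.
    have {}l0 : (l : nat) <> 0%N by move=> h; case/eqP: l0; apply: val_inj; rewrite /= h i0E.
    have {}l1 : (l : nat) <> 1%N by move=> h; case/eqP: l1; apply: val_inj; rewrite /= h i1E.
    rewrite mxE; case: l l0 l1 => [[|[|l]] hl] //= _ _.
    by case: eqP => [/(congr1 val) /= h|_]; [rewrite -h in j2 | rewrite mulr0].
  by rewrite !mxE i0E i1E addr0; case: j j2 => [[|[|j]] hj].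
rewrite (bigD1 j) //= big1 ?addr0 => [|l lj]; last first.
  by rewrite mxE (negPf lj); case: l {lj} => [[|[|l]] hl]; case: j j2 => [[|[|j]] hj] //= _;
    rewrite mulr0.
by rewrite mxE eqxx; case: j j2 => [[|[|j]] hj] //= _; rewrite mulr1.
Qed.

Lemma mul_block2 p q s t p' q' s' t' :
  block2 p q s t *m block2 p' q' s' t' =
  block2 (p * p' + q * s') (p * q' + q * t') (s * p' + t * s') (s * q' + t * t').
Proof.
apply/matrixP=> i j; rewrite [LHS]mxE.
have := sum_block2 p' q' s' t' (block2 p q s t i) j.
under eq_bigr do rewrite intz; move=> ->; rewrite !intz !mxE i0E i1E.
have n0 k (h : (k.+2 < N)%N) : (Ordinal h == i0) = false by apply/eqP=> /(congr1 val) /=;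
  rewrite i0E.
have n1 k (h : (k.+2 < N)%N) : (Ordinal h == i1) = false by apply/eqP=> /(congr1 val) /=;
  rewrite i1E.
by case: i => [[|[|i]] hi]; case: j => [[|[|j]] hj] //=; rewrite ?n0 ?n1 ?mul0r ?addr0.
Qed.

Lemma block2_id : block2 1 0 0 1 = 1%:M.
Proof. by apply/matrixP=> i j; rewrite !mxE; case: i j => [[|[|i]] hi] [[|[|j]] hj]. Qed.

(** The block is the companion matrix of the sixth cyclotomic polynomial [x^2 - x + 1], so its cube
    is -1. *)
Definition rot6 : 'M[int]_N := block2 0 (-1) 1 1.

Lemma mxpow_rot6 : [/\ mxpow rot6 1 = block2 0 (-1) 1 1, mxpow rot6 2 = block2 (-1) (-1) 1 0,
  mxpow rot6 3 = block2 (-1) 0 0 (-1), mxpow rot6 4 = block2 0 1 (-1) (-1) &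
  mxpow rot6 5 = block2 1 1 (-1) 0 /\ mxpow rot6 6 = 1%:M].
Proof.
have E1 : mxpow rot6 1 = block2 0 (-1) 1 1 by rewrite /mxpow /= mulmx1.
have step k p q s t p' q' s' t' : mxpow rot6 k = block2 p q s t ->
    - s = p' -> - t = q' -> p + s = s' -> q + t = t' -> mxpow rot6 k.+1 = block2 p' q' s' t'.
  move=> E <- <- <- <-; rewrite /mxpow /= -/(mxpow rot6 k) E mul_block2.
  by congr block2; ring.
have E2 : mxpow rot6 2 = block2 (-1) (-1) 1 0 by apply: step E1 _ _ _ _.
have E3 : mxpow rot6 3 = block2 (-1) 0 0 (-1) by apply: step E2 _ _ _ _.
have E4 : mxpow rot6 4 = block2 0 1 (-1) (-1) by apply: step E3 _ _ _ _.
have E5 : mxpow rot6 5 = block2 1 1 (-1) 0 by apply: step E4 _ _ _ _.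
by split=> //; split=> //; rewrite -block2_id; apply: step E5 _ _ _ _.
Qed.

Lemma mxpow_rot6_neq1 k : (0 < k < 6)%N -> mxpow rot6 k <> 1%:M.
Proof.
have [E1 E2 E3 E4 [E5 _]] := mxpow_rot6; move=> k6.
have ne p q s t : (p, s) != (1, 0) -> block2 p q s t <> 1%:M.
  move=> ps; rewrite -block2_id => /matrixP h.
  by have := h i0 i0; have := h i1 i0; rewrite !mxE i0E i1E /= => h1 h2; rewrite h1 h2 eqxx in ps.
by case: k k6 => [|[|[|[|[|[|k]]]]]] // _; rewrite ?E1 ?E2 ?E3 ?E4 ?E5; apply: ne.
Qed.

Lemma rot6_unit : rot6 \in unitmx.
Proof.
have [_ _ _ _ [_ E6]] := mxpow_rot6; move: E6; rewrite {1}/mxpow iterS.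
by case/mulmx1_unit.
Qed.

Lemma pull1_rot6 (R : comNzRingType) (phi : endo 'I_N) : abmx phi = rot6 ->
  [/\ pull1 phi (coordf R _ i0) = - coordf R _ i1,
      pull1 phi (coordf R _ i1) = coordf R _ i0 + coordf R _ i1 &
      forall z : {ffun 'I_N -> R}, z i0 = 0 -> z i1 = 0 -> pull1 phi z = z].
Proof.
move=> ab; have E (a : {ffun 'I_N -> R}) j : pull1 phi a j = 
  match j : nat with 0%N => a i1 | 1%N => - a i0 + a i1 | _ => a j end.
  rewrite ffunE mag1_expsum.
  under eq_bigr => i _ do have -> : expsum i (phi j) = rot6 i j by rewrite -ab mxE.
  by rewrite sum_block2; case: j => [[|[|j]] hj] //=; rewrite ?mulr0 ?mulr1 ?mulrN1 ?add0r.
split=> [||z z0 z1]; apply/ffunP=> j; rewrite E.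
- by rewrite !ffunE -!val_eqE /= i0E i1E; case: j => [[|[|j]] hj] //=; rewrite ?oppr0 ?addr0.
- by rewrite !ffunE -!val_eqE /= i0E i1E; case: j => [[|[|j]] hj] //=;
    rewrite ?oppr0 ?addr0 ?add0r.
- case: j => [[|[|j]] hj] //=; rewrite ?z0 ?z1 ?oppr0 ?addr0.
    by rewrite -[LHS]z0; congr (z _); apply: val_inj; rewrite /= i0E.
  by rewrite -[LHS]z1; congr (z _); apply: val_inj; rewrite /= i1E.
Qed.

End Block.

(** Sending the generators with [a x = 1] to a single one and the others to 1 turns [u] into a
    power, with exponent m say. Then [mag2 a a u] is [m(m-1)/2] mod 2, and m is congruent to
    [(m mod 2) + m(m-1)] mod 4. *)
Lemma mag1_lift_mod4 (X : finType) (a : {ffun X -> bool}) (u : word X) :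
  exists k : int, mag1 [ffun x => (a x : nat)%:Z] u =
    (mag1 a u : nat)%:Z + 2 * (mag2 a a u : nat)%:Z + 4 * k.
Proof.
elim: u => [|[x s] u [k IH]]; first by exists 0.
rewrite /= IH /letter1 /letter2 /= ffunE.
by case: s (a x) (mag1 a u) (mag2 a a u) => [] [] [] [] /=;
  first [exists k; lia | exists (k - 1); lia | exists (k + 1); lia].
Qed.

Section OrderSixMatrix.
Variables (N : nat) (i0 i1 : 'I_N) (phi : endo 'I_N).
Hypotheses (i0E : i0 = 0 :> nat) (i1E : i1 = 1 :> nat) (ab : abmx phi = rot6 N).
Local Notation V := {ffun 'I_N -> bool}.
Local Notation e := (coordf bool _ i0).
Local Notation f := (coordf bool _ i1).

Lemma rot6_pull1 : [/\ pull1 phi e = f, pull1 phi f = e + f &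
  forall z : V, off01 i0 i1 z -> pull1 phi z = z].
Proof.
have [E1 E2 E3] := pull1_rot6 i0E i1E bool ab; split=> [||z []] //; last exact: E3.
by rewrite E1; apply/ffunP=> x; rewrite !ffunE.
Qed.

Lemma mul_self (a : V) x (s : int) :
  pull1 phi (pull1 phi (pull1 phi [ffun x => (a x : nat)%:Z])) x = s ->
  s = 0 \/ s = 1 \/ s = -1 -> prd phi a a x = (s == -1).
Proof.
move=> sE s01; rewrite ffunE; have [k] := mag1_lift_mod4 a (epow phi 3 x).
rewrite epowS mag1_ext epowS mag1_ext epowS mag1_ext.
rewrite [epow phi 0 x]/= mag1_gen {}sE.
by case: (mag1 _ _) (mag2 _ _ _) s01 => [] [] /=; case=> [->|[->|->]] /=; lia.
Qed.

Lemma rot6_mul : [/\ prd phi e e = e, prd phi f f = f &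
  forall z : V, off01 i0 i1 z -> prd phi z z = 0].
Proof.
have [E1 E2 E3] := pull1_rot6 i0E i1E int ab.
have lift (k : 'I_N) : [ffun x => (coordf bool _ k x : nat)%:Z] = coordf int _ k.
  by apply/ffunP=> x; rewrite !ffunE; case: (x == k).
have pD (a b : {ffun 'I_N -> int}) : pull1 phi (a + b) = pull1 phi a + pull1 phi b.
  by apply/ffunP=> x; rewrite !ffunE mag1D.
have pN (a : {ffun 'I_N -> int}) : pull1 phi (- a) = - pull1 phi a.
  by apply/eqP; rewrite -addr_eq0 -pD addNr; apply/eqP/ffunP=> x;
    rewrite !ffunE mag1_expsum big1 // => i _; rewrite ffunE mul0r.
split=> [||z [z0 z1]]; apply/ffunP=> x.
- have -> := @mul_self e x (- (x == i0)%:R).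
  + by rewrite ffunE; case: (x == i0).
  + by rewrite lift E1 !(pN, E2, pD) E1 !ffunE; ring.
  + by case: (x == i0); rewrite ?oppr0; [right; right | left].
- have -> := @mul_self f x (- (x == i1)%:R).
  + by rewrite ffunE; case: (x == i1).
  + by rewrite lift !(E1, E2, pD, pN) !ffunE; ring.
  + by case: (x == i1); rewrite ?oppr0; [right; right | left].
- have -> := @mul_self z x (z x : nat).
  + by rewrite ffunE; case: (z x).
  + by rewrite !E3 ?ffunE ?z0 ?z1.
  + by case: (z x); [right; left | left].
Qed.

End OrderSixMatrix.

(** * Out F_n -> GL(n, Z) *)

Lemma nonlift_betaP (n : nat) : (2 < n)%N -> nonlift_beta n.
Proof.
case: n => [|[|[|n]]] // _.
pose i0 : 'I_n.+3 := Ordinal (isT : (0 < n.+3)%N).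
pose i1 : 'I_n.+3 := Ordinal (isT : (1 < n.+3)%N).
pose i2 : 'I_n.+3 := Ordinal (isT : (2 < n.+3)%N).
have [i0E i1E] : i0 = 0 :> nat /\ i1 = 1 :> nat by [].
have [_ _ _ _ [_ E6]] := mxpow_rot6 i0E i1E.
exists (rot6 _), 6; split=> //.
- exact: (rot6_unit i0E i1E).
- exact: (mxpow_rot6_neq1 i0E i1E).
move=> phi _ ab [w /feqP phi6].
have [Se Sf Sz] := rot6_pull1 i0E i1E ab; have [mee mff mzz] := rot6_mul i0E i1E ab.
by apply: (@order_six_free _ i0 i1 i2 [::] phi w) => //; [left | exact: ext_stable_nil].
Qed.

(** * Out_+ pi_1(F_g) -> Sp(2g, Z) *)

Section HandleIndices.
Variable g : nat.
Implicit Types k l : 'I_g.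

Lemma sa_eq k l : (sa k == sa l) = (k == l).
Proof. by rewrite -!val_eqE /= -!muln2 eqn_pmul2r. Qed.

Lemma sb_eq k l : (sb k == sb l) = (k == l).
Proof. by rewrite -!val_eqE /= eqSS -!muln2 eqn_pmul2r. Qed.

Lemma sa_sb_eq k l : (sa k == sb l) = false.
Proof. by apply/eqP=> /(congr1 (fun i : 'I__ => odd i)) /=; rewrite !odd_double. Qed.

Lemma sb_sa_eq k l : (sb k == sa l) = false.
Proof. by rewrite eq_sym sa_sb_eq. Qed.

Definition handle_eqE := (sa_eq, sb_eq, sa_sb_eq, sb_sa_eq).

End HandleIndices.

Definition handles (g : nat) (s : seq 'I_g) : word 'I_(2 * g) :=
  flatten [seq commw (gen (sa k)) (gen (sb k)) | k <- s].

Lemma mag1_handles (R : comNzRingType) g s (a : {ffun 'I_(2 * g) -> R}) :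
  mag1 a (handles s) = 0.
Proof.
by rewrite /handles; elim: s => [|k s IH] //=; rewrite IH /letter1 /=; ring.
Qed.

(** The quadratic part of a product of commutators is the intersection form of its handles. *)
Lemma mag2_handles (R : comNzRingType) g s (a b : {ffun 'I_(2 * g) -> R}) :
  mag2 a b (handles s) = \sum_(k <- s) (a (sa k) * b (sb k) - a (sb k) * b (sa k)).
Proof.
rewrite /handles; elim: s => [|k s IH]; first by rewrite big_nil.
by rewrite big_cons -IH /= /letter1 /letter2 /=; ring.
Qed.

Section Relation.
Variables (R : comNzRingType) (g : nat).
Implicit Types (a b : {ffun 'I_(2 * g) -> R}).

Lemma mag1_rel a : mag1 a (Defs.rel g) = 0.
Proof. exact: mag1_handles. Qed.

Lemma mag2_rel a b :
  mag2 a b (Defs.rel g) = \sum_(k < g) (a (sa k) * b (sb k) - a (sb k) * b (sa k)).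
Proof. by rewrite -big_enum; apply: mag2_handles. Qed.

End Relation.

(** The block has determinant 1 and acts on the first handle only. *)
Lemma rot6_sp (g : nat) : (0 < g)%N -> is_sp (rot6 (2 * g)).
Proof.
move=> g0; have h0 : (0 < 2 * g)%N by lia. have h1 : (1 < 2 * g)%N by lia.
pose i0 := Ordinal h0; pose i1 := Ordinal h1.
have [i0E i1E] : i0 = 0 :> nat /\ i1 = 1 :> nat by [].
apply/matrixP=> i j; rewrite mxE.
have E (v : 'I_(2 * g) -> int) k : \sum_l v l * rot6 (2 * g) l k =
    match k : nat with 0%N => v i1 | 1%N => - v i0 + v i1 | _ => v k end.
  have := sum_block2 i0E i1E 0 (-1) 1 1 v k; under eq_bigr do rewrite intz.
  by move=> ->; case: k => [[|[|k]] hk] //=; rewrite ?mulr0 ?mulr1 ?mulrN1 ?add0r.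
have Ei l : ((rot6 (2 * g))^T *m Jmx g) i l =
    match i : nat with 0%N => Jmx g i1 l | 1%N => - Jmx g i0 l + Jmx g i1 l | _ => Jmx g i l end.
  rewrite -(E (fun k => Jmx g k l)) mxE; apply: eq_bigr => k _.
  by rewrite mxE mulrC.
rewrite (E (fun l => ((rot6 (2 * g))^T *m Jmx g) i l)) !Ei !mxE i0E i1E /=.
case: i {Ei} => [[|[|i]] hi]; case: j => [[|[|j]] hj] //=.
- by case: j {hj} => [|j] //=; rewrite !andbF.
- by case: j {hj} => [|j] //=; rewrite !andbF ?oppr0 ?addr0.
- by case: i {hi} => [|i] //=; rewrite !andbF.
- by case: i {hi} => [|i] //=; rewrite !andbF ?oppr0 ?addr0.
Qed.

Lemma nonlift_deltaP (g : nat) : (2 <= g)%N -> nonlift_delta g.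
Proof.
move=> g2; have g0 : (0 < g)%N by lia.
pose k0 : 'I_g := Ordinal g0; pose k1 : 'I_g := Ordinal g2.
pose i0 := sa k0; pose i1 := sb k0; pose i2 := sa k1; pose i3 := sb k1.
have [i0E i1E] : i0 = 0 :> nat /\ i1 = 1 :> nat by [].
have [_ _ _ _ [_ E6]] := mxpow_rot6 i0E i1E.
exists (rot6 _), 6; split=> //.
- exact: rot6_sp.
- exact: (mxpow_rot6_neq1 i0E i1E).
move=> phi [stable _] _ ab [w phi6].
have [Se Sf Sz] := rot6_pull1 i0E i1E ab; have [mee mff mzz] := rot6_mul i0E i1E ab.
pose c i := coordf bool _ i : {ffun 'I_(2 * g) -> bool}.
have om_ab k : omf (Defs.rel g) (c (sa k)) (c (sb k)) = 1.
  rewrite /omf mag2_rel (bigD1 k) //= big1 => [|l lk].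
    by rewrite !ffunE !handle_eqE eqxx.
  by rewrite !ffunE !handle_eqE (negPf lk).
have om_z (z : {ffun 'I_(2 * g) -> bool}) : off01 i0 i1 z ->
    omf (Defs.rel g) (c i0) z = 0 /\ omf (Defs.rel g) (c i1) z = 0.
  move=> [z0 z1]; rewrite /omf !mag2_rel; split; apply: big1 => l _;
    rewrite !ffunE !handle_eqE ?mul0r ?subr0 ?sub0r;
    by case: eqP => [->|_]; rewrite ?z0 ?z1 ?mulr0 ?mul0r ?oppr0.
have k01 : (k0 == k1) = false by [].
have off2 : off01 i0 i1 (c i2) by rewrite /off01 !ffunE !handle_eqE k01.
have off3 : off01 i0 i1 (c i3) by rewrite /off01 !ffunE !handle_eqE k01.
apply: (@order_six_surface _ i0 i1 i2 (Defs.rel g) phi w _ _ _ Se Sf Sz mee mff mzz _ _ _ _ _ _ _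
  (c i2) (c i3)) => //.
- exact: mag1_rel.
- by right; exists (c i0), (c i1); apply: om_ab.
- by move=> a; rewrite /omf mag2_rel; apply: big1 => k _; rewrite mulrC subrr.
- by move=> z /om_z[].
- by move=> z /om_z[].
- exact: om_ab.
- exact: om_ab.
Qed.

(** * Aut pi_1(F_g) -> Out pi_1(F_g) *)

Lemma mag1_coordf (R : comNzRingType) (X : finType) (a : {ffun X -> R}) (u : word X) :
  mag1 a u = \sum_i a i * mag1 (coordf R X i) u.
Proof.
rewrite mag1_expsum; apply: eq_bigr => i _; congr (_ * _); rewrite mag1_expsum.
rewrite (bigD1 i) //= ffunE eqxx mul1r big1 ?addr0 // => j ji.
by rewrite ffunE (negPf ji) mul0r.
Qed.

Lemma central_mag1 (R : comNzRingType) (g : nat) (z : word 'I_(2 * g))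
    (a : {ffun 'I_(2 * g) -> R}) : (2 <= g)%N ->
  (forall x, eqr (Defs.rel g) (z ++ gen x) (gen x ++ z)) -> mag1 a z = 0.
Proof.
move=> g2 zC; have g0 : (0 < g)%N by lia.
rewrite mag1_coordf big1 // => i _.
suff -> : mag1 (coordf R _ i) z = 0 by rewrite mulr0.
(* A handle that does not contain the generator [i]; two handles suffice for the choice. *)
pose l : 'I_g := if (i < 2)%N then Ordinal g2 else Ordinal g0.
have il : (i != sa l) /\ (i != sb l).
  by rewrite -!val_eqE /= /l; case: ltnP => /= h; split; apply/eqP; lia.
have := mag1_central (mag1_rel (R := R) (g := g)) (zC (sa l)) (a := coordf R _ i)
  (b := coordf R _ (sa l)).
rewrite !ffunE eqxx [sa l == i]eq_sym (negPf il.1) mulr1 mul0r; apply.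
rewrite mag2_rel big1 // => m _; rewrite !ffunE !handle_eqE mulr0 sub0r.
case: (eqVneq m l) => [->|ml]; last by rewrite mulr0 oppr0.
by rewrite [_ == i]eq_sym (negPf il.2) mul0r oppr0.
Qed.

Section Flatten.
Variables (X : eqType) (r : word X) (I : eqType).

#[local] Instance commw_proper : Proper (eqr r ==> eqr r ==> eqr r) (@commw X).
Proof. by move=> u u' uu' v v' vv'; rewrite /commw uu' vv'. Qed.

Lemma ext_commw (e : endo X) x y :
  eqr r (ext e (commw (gen x) (gen y))) (commw (e x) (e y)).
Proof. by rewrite /commw !(ext_cat, ext_winv) !ext_gen. Qed.

Lemma commw_conj (w u v : word X) :
  eqr r (commw (w ++ u ++ winv w) (w ++ v ++ winv w)) (w ++ commw u v ++ winv w).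
Proof. by rewrite /commw !winv_cat winvK -!catA !eqr_catKV. Qed.

Lemma ext_flatten (e : endo X) (w : word X) (F G : I -> word X) (s : seq I) :
  {in s, forall i, eqr r (ext e (F i)) (w ++ G i ++ winv w)} ->
  eqr r (ext e (flatten [seq F i | i <- s])) (w ++ flatten [seq G i | i <- s] ++ winv w).
Proof.
elim: s => [|i s IH] h; first by rewrite /= eqr_catV.
rewrite /= ext_cat h ?mem_head // IH => [|j js]; last by rewrite h // inE js orbT.
by rewrite -!catA eqr_catKV.
Qed.

End Flatten.

Lemma winv_commw (X : eqType) (u v : word X) : winv (commw u v) = commw v u.
Proof. by rewrite /commw !winv_cat !winvK -!catA. Qed.

Lemma winv_flatten (X : eqType) (ss : seq (word X)) :
  winv (flatten ss) = flatten (rev [seq winv u | u <- ss]).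
Proof.
by elim: ss => //= u ss IH; rewrite winv_cat IH rev_cons -cats1 flatten_cat /= cats0.
Qed.

Lemma mem_take_enum_ord n k (i : 'I_n) : (i \in take k (enum 'I_n)) = (i < k)%N.
Proof. by rewrite in_take ?mem_enum // index_enum_ord. Qed.

Lemma inner_surf_pull1 (R : comNzRingType) g (e : endo 'I_(2 * g)) (a : {ffun 'I_(2 * g) -> R}) :
  inner_surf e -> pull1 e a = a.
Proof.
case=> w ew; apply/ffunP=> x; rewrite ffunE (mag1_eqr (@mag1_rel R g) a (ew x)).
by rewrite mag1_conj mag1_gen.
Qed.

Lemma inner_power_aut_surf g (e : endo 'I_(2 * g)) m v : ext_stable (Defs.rel g) e ->
  (forall x, eqr (Defs.rel g) (epow e m x) (v ++ gen x ++ winv v)) ->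
  eqr (Defs.rel g) (ext e v) v -> (0 < m)%N -> is_aut_surf e.
Proof.
move=> er em ev m0; split=> //.
by have [e' [? ? ?]] := inner_power_invertible er em ev m0; exists e'.
Qed.

(* The quotient is the nonorientable surface with group <p_i, q_i, c | P c^2>, where P is the
   product of the k commutators [p_i, q_i], and the involution is conjugation by c. *)
Section EvenGenus.
Variable k : nat.
Hypothesis k_gt0 : (0 < k)%N.
Notation g := (2 * k)%N.
Notation X := 'I_(2 * g).
Notation r := (Defs.rel g).

Let s1 : seq 'I_g := take k (enum 'I_g).
Let P : word X := handles s1.
Let P' : word X := flatten [seq commw (gen (rev_ord (sa i))) (gen (rev_ord (sb i))) | i <- s1].

(** Index reversal exchanges [a_i] with [b_(g-1-i)], hence the two halves of the handles.
    Conjugating one half makes the square equal to conjugation by [P^-1]. *)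
Definition antipode : endo X := fun x =>
  if (x < g)%N then gen (rev_ord x) else winv P ++ gen (rev_ord x) ++ P.

Lemma rev_sa (i : 'I_g) : rev_ord (sa i) = sb (rev_ord i).
Proof. by apply: val_inj => /=; have := ltn_ord i; lia. Qed.

Lemma rev_sb (i : 'I_g) : rev_ord (sb i) = sa (rev_ord i).
Proof. by apply: val_inj => /=; have := ltn_ord i; lia. Qed.

(** Reversal inverts the order of the handles and exchanges the two entries of each commutator, so
    the second half of the relator is [P'^-1]. *)
Lemma rel_even : r = P ++ winv P'.
Proof.
rewrite /Defs.rel -{1}(cat_take_drop k (enum 'I_g)) map_cat flatten_cat; congr (_ ++ _).
rewrite winv_flatten -map_comp -map_rev -/s1.
have -> : drop k (enum 'I_g) = [seq rev_ord i | i <- rev s1].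
  apply: (inj_map val_inj); rewrite -map_comp map_drop val_enum_ord drop_iota add0n.
  have -> : (g - k = k)%N by lia.
  have -> : [seq (val \o @rev_ord g) i | i <- rev s1] = rev [seq (g - i.+1)%N | i <- iota 0 k].
    rewrite map_rev; congr rev; rewrite -[k]/(0 + k)%N.
    transitivity [seq (g - i.+1)%N | i <- map val s1]; first by rewrite -map_comp.
    by rewrite map_take val_enum_ord take_iota (minn_idPl _) // leq_pmull.
  apply: (@eq_from_nth _ 0%N); rewrite ?size_rev ?size_map ?size_iota // => i ik.
  rewrite nth_iota // nth_rev size_map size_iota // (nth_map 0%N) ?size_iota; last by lia.
  by rewrite nth_iota; lia.
rewrite -map_comp; congr flatten; apply: eq_map => i /=.
by rewrite winv_commw rev_sa rev_sb.
Qed.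

Lemma P_eq_P' : eqr r P P'.
Proof. by rewrite /eqr -rel_even; apply: in_ncl_rel. Qed.

Lemma antipode_lt (x : X) : (x < g)%N -> antipode x = gen (rev_ord x).
Proof. by rewrite /antipode => ->. Qed.

Lemma antipode_ge (x : X) : (g <= x)%N -> antipode x = winv P ++ gen (rev_ord x) ++ P.
Proof. by rewrite /antipode leqNgt => /negPf ->. Qed.

Lemma ext_antipode_P : eqr r (ext antipode P) P'.
Proof.
have := @ext_flatten _ r _ antipode [::] (fun i => commw (gen (sa i)) (gen (sb i)))
  (fun i : 'I_g => commw (gen (rev_ord (sa i))) (gen (rev_ord (sb i)))) s1.
rewrite cats0; apply=> i; rewrite mem_take_enum_ord cats0 => ik.
by rewrite ext_commw !antipode_lt //=; lia.
Qed.

Lemma ext_antipode_P' : eqr r (ext antipode P') P.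
Proof.
transitivity (winv P ++ P ++ winv (winv P)); last by rewrite winvK eqr_catKV.
apply: ext_flatten => i; rewrite mem_take_enum_ord => ik.
rewrite ext_commw !antipode_ge /=; [|lia|lia].
have conjE y : winv P ++ gen y ++ P = winv P ++ gen y ++ winv (winv P) by rewrite winvK.
by rewrite !rev_ordK !conjE commw_conj.
Qed.

Lemma antipode_stable : ext_stable r antipode.
Proof.
apply/in_nclP; rewrite {2}rel_even ext_cat ext_winv ext_antipode_P ext_antipode_P' P_eq_P'.
by rewrite eqr_catV.
Qed.

Lemma antipode_sq (x : X) : eqr r (epow antipode 2 x) (winv P ++ gen x ++ winv (winv P)).
Proof.
rewrite epowS epowS winvK; have e1 := ext_gen [::] antipode x.
rewrite (ext_eqr antipode_stable (eqr0_eqr r e1)).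
case: (ltnP x g) => xg.
  rewrite antipode_lt // ext_gen antipode_ge ?rev_ordK //=; lia.
rewrite antipode_ge // !(ext_cat, ext_winv) ext_gen antipode_lt; last by rewrite /=; lia.
by rewrite ext_antipode_P -P_eq_P' rev_ordK.
Qed.

Lemma pull1_antipode (x : X) :
  pull1 antipode (coordf bool _ x) = coordf bool _ (rev_ord x).
Proof.
apply/ffunP=> y; rewrite !ffunE -(inv_eq rev_ordK) eq_sym.
suff -> : mag1 (coordf bool _ x) (antipode y) = coordf bool _ x (rev_ord y).
  by rewrite ffunE eq_sym.
rewrite /antipode; case: ifP => _; first by rewrite mag1_gen.
by rewrite !mag1_cat mag1_winv mag1_handles mag1_gen oppr0 add0r addr0.
Qed.

Lemma pull2_antipode (a b : {ffun X -> bool}) : pull2 antipode a b = 0.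
Proof.
apply/ffunP=> y; rewrite !ffunE /antipode; case: ifP => _; first by rewrite mag2_gen.
rewrite !(mag2_cat, mag1_cat) mag2_winv mag2_gen mag1_winv !mag1_handles.
by boolean.
Qed.

Lemma nonlift_gamma_even : nonlift_gamma g.
Proof.
have g2 : (2 <= g)%N by lia.
exists antipode, 2; split=> //.
- apply: (inner_power_aut_surf antipode_stable antipode_sq) => //.
  by rewrite ext_winv ext_antipode_P -P_eq_P'.
- by exists (winv P) => x; apply: antipode_sq.
- move=> [|[|j]] // _ h.
  have x0 : (0 < 2 * g)%N by lia.
  have := inner_surf_pull1 (coordf bool _ (Ordinal x0)) h.
  move=> /ffunP/(_ (rev_ord (Ordinal x0))); rewrite !ffunE epowS mag1_ext mag1_gen.
  rewrite pull1_antipode !ffunE eqxx -val_eqE /=.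
  by case: eqP => //; lia.
move=> u h; have [z zE] : exists z, z = u ++ ext antipode u ++ winv P by eexists.
have zC x : eqr r (z ++ gen x) (gen x ++ z).
  have := conj_pow_central antipode_sq h x; rewrite zE /= -[ext antipode [::]]/[::] cats0.
  by rewrite -!catA.
have g0 : (0 < g)%N by lia.
pose k0 : 'I_g := Ordinal g0; pose k1 : 'I_g := rev_ord k0.
have kk1 : (k <= k1)%N by rewrite /=; lia.
have k01 : (k0 == k1) = false by apply/eqP=> /(congr1 val) /=; lia.
have k10 : (k1 == k0) = false by rewrite eq_sym.
pose c (i : X) : {ffun X -> bool} := coordf bool _ i.
set a := c (sa k0); set b := c (sb k0); set a' := c (sb k1); set b' := c (sa k1).
have z1 (d : {ffun X -> bool}) : mag1 d z = 0 by apply: central_mag1.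
have r0 := @mag1_rel bool g.
have omab : mag2 a b r = 1.
  rewrite mag2_rel (bigD1 k0) //= big1 => [|l lk]; rewrite !ffunE !handle_eqE ?eqxx //.
  by rewrite (negPf lk).
have omab' : mag2 a' b' r = 1.
  rewrite mag2_rel (bigD1 k1) //= big1 => [|l lk]; rewrite !ffunE !handle_eqE ?eqxx //.
  by rewrite (negPf lk).
have oma'a : mag2 a' a r = 0.
  rewrite mag2_rel big1 // => l _; rewrite !ffunE !handle_eqE.
  by case: (eqVneq l k1) => [->|_]; rewrite ?k10.
have oma'a' : mag2 a' a' r = 0.
  by rewrite mag2_rel big1 // => l _; rewrite mulrC subrr.
(* The quadratic part of the central [z] must be a multiple of the intersection form: both terms
   equal [t a']. *)
have y0 : mag2 a b z + mag2 a' b' z = 0.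
  have [||t ht] := mag3_eqr r0 (zC (sb k1)); first by right; exists a, b.
    by move=> d d'; rewrite !mag2_cat !z1 mag2_gen mulr0 mul0r !addr0 add0r.
  have := ht a' a b; have := ht a' a' b'.
  rewrite !mag3_cat mag3_gen !mag2_gen !mag1_gen omab omab' oma'a oma'a' !z1.
  have a'x : a' (sb k1) = 1 by rewrite ffunE eqxx.
  have bx : b (sb k1) = 0 by rewrite ffunE sb_eq k10.
  have b'x : b' (sb k1) = 0 by rewrite ffunE sb_sa_eq.
  rewrite a'x bx b'x.
  by case: (mag3 _ _ _ _) (mag3 _ _ _ _) (mag2 a b z) (mag2 a' b' z) (t a') => [] [] [] [] [];
    rewrite ?mulr0 ?mul0r; boolean.
have pa : pull1 antipode a = a' by rewrite pull1_antipode rev_sa.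
have pb : pull1 antipode b = b' by rewrite pull1_antipode rev_sb.
have pa' : pull1 antipode a' = a by rewrite pull1_antipode rev_sb rev_ordK.
have pb' : pull1 antipode b' = b by rewrite pull1_antipode rev_sa rev_ordK.
have ez (d d' : {ffun X -> bool}) : mag2 d d' z = mag2 d d' u + mag1 d u * mag1
  (pull1 antipode d') u +
    mag2 (pull1 antipode d) (pull1 antipode d') u + mag2 d d' P.
  rewrite zE !(mag2_cat, mag1_cat, mag2_ext, mag1_ext) mag2_winv mag1_winv !mag1_handles.
  rewrite pull2_antipode.
  have -> : mag1 (0 : {ffun X -> bool}) u = 0.
    by have := mag1D (0 : {ffun X -> bool}) 0 u; rewrite addr0; case: (mag1 _ _).
  by boolean.
have Pab : mag2 a b P = 1.
  rewrite mag2_handles (bigD1_seq k0) /=; last 2 first.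
  - by rewrite mem_take_enum_ord.
  - by rewrite take_uniq ?enum_uniq.
  rewrite big1 => [|l lk]; rewrite !ffunE !handle_eqE ?eqxx //.
  by rewrite (negPf lk).
have Pab' : mag2 a' b' P = 0.
  rewrite mag2_handles big_seq big1 // => l; rewrite mem_take_enum_ord => lk.
  have lk1 : (l == k1) = false.
    by apply/eqP => lk1; rewrite lk1 ltnNge kk1 in lk.
  by rewrite !ffunE !handle_eqE lk1 !mul0r subrr.
(* The involution exchanges [a] with [a'] and [b] with [b'], so all terms in [u] cancel in pairs,
   given [z_1 = 0]. What is left is the coefficient 1 of [P]. *)
move: y0; rewrite !ez pa pb pa' pb' Pab Pab'.
have := z1 a; have := z1 b; rewrite zE !(mag1_cat, mag1_ext, mag1_winv, mag1_handles) pa pb.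
by move: (mag1 a u) (mag1 a' u) (mag1 b u) (mag1 b' u) (mag2 a b u) (mag2 a' b' u) =>
  [] [] [] [] [] [].
Qed.

End EvenGenus.

(* The surface of genus 2 k + 1 is a double cover of the one of genus k + 1; the deck
   transformation is conjugation by a generator of the larger group whose square is d. *)
Section OddGenus.
Variable k : nat.
Hypothesis k_gt0 : (0 < k)%N.
Notation g := (2 * k).+1.
Notation X := 'I_(2 * g).
Notation r := (Defs.rel g).

Let mid : 'I_g := inord k.
Let shift (i : 'I_g) : 'I_g := inord (i + k.+1).
Let s1 : seq 'I_g := take k (enum 'I_g).
Let P' : word X := handles s1.
Let P : word X := handles [seq shift i | i <- s1].
Let d : word X := gen (sa mid).
Let t : word X := gen (sb mid).

Lemma mid_val : mid = k :> nat.
Proof. by rewrite inordK //; lia. Qed.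

Lemma shift_val (i : 'I_g) : (i < k)%N -> shift i = (i + k.+1)%N :> nat.
Proof. by move=> ik; rewrite inordK //; lia. Qed.

(** A shift by [k + 1] handles. The default [x] is reached only outside the first [k] handles, where
    [deck] does not call it. *)
Definition deck_shift (x : X) : X := insubd x (x + 2 * k.+1)%N.
Definition deck_unshift (x : X) : X := insubd x (x - 2 * k.+1)%N.

Definition deck : endo X := fun x =>
  if (x < 2 * k)%N then d ++ gen (deck_shift x) ++ winv d
  else if x == sa mid then d
  else if x == sb mid then winv P ++ t
  else gen (deck_unshift x).

Lemma rel_odd : r = P' ++ commw d t ++ P.
Proof.
rewrite /Defs.rel; have -> : enum 'I_g = s1 ++ mid :: [seq shift i | i <- s1].
  apply: (inj_map val_inj); rewrite map_cat /= -map_comp mid_val.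
  have s1E : map val s1 = iota 0 k.
    by rewrite map_take val_enum_ord take_iota (minn_idPl _) //; lia.
  have -> : map (val \o shift) s1 = iota k.+1 k.
    rewrite -[k.+1]addn0 iotaDl -s1E -map_comp; apply/eq_in_map => i.
    by rewrite mem_take_enum_ord /= => ik; rewrite shift_val // addnC.
  rewrite s1E val_enum_ord -[k :: _]/(iota k k.+1) -[X in iota X k.+1]add0n -iotaD.
  by congr iota; lia.
by rewrite map_cat flatten_cat.
Qed.

Lemma deck_mid_a : deck (sa mid) = d.
Proof. by rewrite /deck /= mid_val eqxx ifF //; lia. Qed.

Lemma deck_mid_b : deck (sb mid) = winv P ++ t.
Proof. by rewrite /deck sb_sa_eq eqxx /= mid_val ifF //; lia. Qed.

Lemma deck_lt (x : X) : (x < 2 * k)%N -> deck x = d ++ gen (deck_shift x) ++ winv d.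
Proof. by rewrite /deck => ->. Qed.

Lemma deck_ge (x : X) : (2 * k.+1 <= x)%N -> deck x = gen (deck_unshift x).
Proof.
by move=> kx; rewrite /deck ifF ?ifF ?ifF //; rewrite -?val_eqE /= ?mid_val; lia.
Qed.

Lemma deck_shift_val (x : X) : (x < 2 * k)%N -> deck_shift x = (x + 2 * k.+1)%N :> nat.
Proof. by move=> xk; rewrite val_insubd ifT //; lia. Qed.

Lemma deck_unshift_val (x : X) : deck_unshift x = (x - 2 * k.+1)%N :> nat.
Proof. by rewrite val_insubd ifT //; have := ltn_ord x; lia. Qed.

Lemma ext_deck_P : eqr r (ext deck P) P'.
Proof.
have := @ext_flatten _ r _ deck [::] (fun i : 'I_g => commw (gen (sa (shift i))) (gen (sb
  (shift i))))
  (fun i : 'I_g => commw (gen (sa i)) (gen (sb i))) s1.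
rewrite cats0 /P /handles -map_comp; apply=> i; rewrite mem_take_enum_ord cats0 => ik.
rewrite ext_commw !deck_ge /= ?shift_val //; [|lia|lia].
have -> : deck_unshift (sa (shift i)) = sa i.
  by apply: val_inj; rewrite /= deck_unshift_val /= shift_val //; lia.
have -> // : deck_unshift (sb (shift i)) = sb i.
by apply: val_inj; rewrite /= deck_unshift_val /= shift_val //; lia.
Qed.

Lemma ext_deck_P' : eqr r (ext deck P') (d ++ P ++ winv d).
Proof.
rewrite /P /handles -map_comp; apply: ext_flatten => i; rewrite mem_take_enum_ord => ik.
rewrite ext_commw !deck_lt; [|rewrite /=; lia|rewrite /=; lia]; rewrite commw_conj.
have -> : deck_shift (sa i) = sa (shift i).
  by apply: val_inj; rewrite /= deck_shift_val /= ?shift_val //; lia.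
have -> // : deck_shift (sb i) = sb (shift i).
by apply: val_inj; rewrite /= deck_shift_val /= ?shift_val //; lia.
Qed.

Lemma rel_rotated : eqr r (d ++ t ++ winv d ++ winv t ++ P ++ P') [::].
Proof.
have /in_nclP := in_ncl_conj (winv P') (in_ncl_rel r).
by rewrite {2}rel_odd winvK /commw -!catA eqr_catKV.
Qed.

(** The factor [P^-1] in the image of [t] turns the image of the relator into its rotation [[d, t] P
    P']. *)
Lemma deck_stable : ext_stable r deck.
Proof.
apply/in_nclP; rewrite {2}rel_odd /commw !(ext_cat, ext_winv) ext_deck_P' ext_deck_P.
rewrite !ext_gen deck_mid_a deck_mid_b winv_cat winvK -!catA eqr_catKV eqr_catVK.
exact: rel_rotated.
Qed.

Lemma deck_sq (x : X) : eqr r (epow deck 2 x) (d ++ gen x ++ winv d).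
Proof.
rewrite epowS epowS; have e1 := ext_gen [::] deck x.
rewrite (ext_eqr deck_stable (eqr0_eqr r e1)).
case: (ltnP x (2 * k)) => xk.
  rewrite deck_lt // !(ext_cat, ext_winv) !ext_gen deck_mid_a deck_ge; last first.
    by rewrite deck_shift_val //; lia.
  have -> // : deck_unshift (deck_shift x) = x.
  by apply: val_inj; rewrite /= deck_unshift_val deck_shift_val //; lia.
case: (eqVneq x (sa mid)) => [->|xa].
  by rewrite deck_mid_a ext_gen deck_mid_a eqr_catV cats0.
case: (eqVneq x (sb mid)) => [->|xb].
  rewrite deck_mid_b ext_cat ext_winv ext_deck_P ext_gen deck_mid_b.
  (* The rotated relator says [d t d^-1 = P'^-1 P^-1 t]. *)
  have <- : eqr r (winv P' ++ winv P ++ t ++ winv d ++ d) (winv P' ++ winv P ++ t).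
    by rewrite eqr_Vcat cats0.
  apply: eqr_sym; rewrite -[gen (sb mid)]/t.
  have := rel_rotated => /(fun h => eqr_cat h (eqr_refl r (winv P' ++ winv P ++ t))).
  by rewrite -!catA eqr_catVK eqr_catVK eqr_catKV eqr_Vcat cats0.
have kx : (2 * k.+1 <= x)%N.
  by move: xa xb; rewrite -!val_eqE /= mid_val => /eqP + /eqP; lia.
rewrite deck_ge // ext_gen deck_lt ?deck_unshift_val; last by have := ltn_ord x; lia.
have -> // : deck_shift (deck_unshift x) = x.
apply: val_inj; rewrite /= deck_shift_val deck_unshift_val; first by lia.
by have := ltn_ord x; lia.
Qed.

Lemma pull1_deck : pull1 deck (coordf bool _ (sa mid)) = coordf bool _ (sa mid).
Proof.
apply/ffunP=> x; rewrite ffunE; case: (ltnP x (2 * k)) => xk.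
  rewrite deck_lt // mag1_conj mag1_gen !ffunE -!val_eqE /= deck_shift_val // mid_val.
  by congr (_%:R); apply/eqP/eqP; lia.
case: (eqVneq x (sa mid)) => [->|xa]; first by rewrite deck_mid_a mag1_gen.
case: (eqVneq x (sb mid)) => [->|xb].
  by rewrite deck_mid_b mag1_cat mag1_winv mag1_handles mag1_gen oppr0 add0r.
have kx : (2 * k.+1 <= x)%N.
  by move: xa xb; rewrite -!val_eqE /= mid_val => /eqP + /eqP; lia.
rewrite deck_ge // mag1_gen !ffunE (negPf xa) -val_eqE /= deck_unshift_val mid_val.
by case: eqP => //; have := ltn_ord x; lia.
Qed.

Lemma nonlift_gamma_odd : nonlift_gamma g.
Proof.
have g2 : (2 <= g)%N by lia.
exists deck, 2; split=> //.
- by apply: (inner_power_aut_surf deck_stable deck_sq) => //; rewrite ext_gen deck_mid_a.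
- by exists d => x; apply: deck_sq.
- move=> [|[|j]] // _ h.
  have x0 : (0 < 2 * g)%N by lia.
  have := inner_surf_pull1 (coordf bool _ (Ordinal x0)) h.
  move=> /ffunP/(_ (Ordinal x0)); rewrite !ffunE epowS mag1_ext mag1_gen ffunE deck_lt;
    last by rewrite /=; lia.
  by rewrite mag1_conj mag1_gen ffunE eqxx -val_eqE /= deck_shift_val /=; [|lia].
(* The form dual to [d] is invariant, so on [z = u deck(u) d] it takes the value [2 u_1 + 1], which
   is nonzero mod 2. *)
move=> u h; have := central_mag1 (coordf bool _ (sa mid)) g2 (conj_pow_central deck_sq h).
rewrite /conj_pow !(mag1_cat, mag1_ext) !pull1_deck mag1_gen ffunE eqxx /= addr0.
by move: (mag1 _ u) => [].
Qed.

End OddGenus.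

Lemma nonlift_gammaP (g : nat) : (2 <= g)%N -> nonlift_gamma g.
Proof.
move=> g2; have := odd_double_half g; rewrite -mul2n; case: odd => gE; rewrite -gE in g2 *.
  by apply: nonlift_gamma_odd; lia.
by apply: nonlift_gamma_even; lia.
Qed.

Local Close Scope ring_scope.

(** * Aut F_n -> Out F_n *)

Section Rotation.
Variable m : nat.
Hypothesis m_gt1 : 1 < m.
Notation X := 'I_m.+1.
Implicit Types (x : X) (k : nat).

(* The rotation of a circle of length m (the generator 0) with a loop attached at
   each of its m vertices. *)
Definition rotation : endo X := fun x =>
  if x == ord0 then gen x
  else if x < m then gen (inord x.+1) else gen ord0 ++ gen (inord 1) ++ winv (gen ord0).

(** For [k <= m] a loop passes the base vertex at most once, which costs at most one conjugation by
    the circle. *)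
Lemma epow_rotation k x : k <= m ->
  eqr [::] (epow rotation k x)
    (if x == ord0 then gen x else if x + k <= m then gen (inord (x + k))
     else gen ord0 ++ gen (inord (x + k - m)) ++ winv (gen ord0)).
Proof.
elim: k => [_|k IH lt_km].
  by rewrite addn0 -ltnS ltn_ord inord_val if_same.
rewrite epowS (IH (ltnW lt_km)).
have E0 : rotation ord0 = gen ord0 by [].
case: (eqVneq x ord0) => [->|x0]; first by rewrite ext_gen E0.
have x_gt0 : 0 < x by rewrite lt0n; apply: contraNneq x0 => h; apply/eqP/val_inj.
have x_le : x <= m by rewrite -ltnS.
have rot y : 0 < y -> y <= m -> rotation (inord y) =
    if y < m then gen (inord y.+1) else gen ord0 ++ gen (inord 1) ++ winv (gen ord0).
  move=> y0 ym; rewrite /rotation inordK //.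
  by case: eqP => // /(congr1 val) /=; rewrite inordK // => h; rewrite h in y0.
case: (leqP (x + k) m) => xk.
  rewrite ext_gen rot //; last by lia.
  case: ltnP => h; first by rewrite addnS h.
  by rewrite leqNgt addnS ltnS h /=; have -> : (x + k).+1 - m = 1 by lia.
rewrite !ext_cat ext_winv !ext_gen E0 rot; [|lia|lia].
have -> : (x + k - m < m) = true by lia.
have -> : (x + k.+1 <= m) = false by lia.
by have -> : x + k.+1 - m = (x + k - m).+1 by lia.
Qed.

Lemma epow_rotation_inner x :
  eqr [::] (epow rotation m x) (gen ord0 ++ gen x ++ winv (gen ord0)).
Proof.
rewrite epow_rotation //; case: (eqVneq x ord0) => [->|x0]; first by rewrite eqr_catV cats0.
have x_gt0 : 0 < x by rewrite lt0n; apply: contraNneq x0 => h; apply/eqP/val_inj.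
have -> : (x + m <= m) = false by lia.
by rewrite addnK inord_val.
Qed.

Lemma pull1_rotation : pull1 rotation (coordf int X ord0) = coordf int X ord0.
Proof.
apply/ffunP=> x; rewrite !ffunE /rotation; case: (eqVneq x ord0) => [->|x0].
  by rewrite mag1_gen ffunE eqxx.
case: ifP => [xm|_]; last first.
  rewrite mag1_conj mag1_gen ffunE; case: eqP => // /(congr1 val) /=.
  by rewrite inordK //; lia.
by rewrite mag1_gen ffunE; case: eqP => // /(congr1 val) /=; rewrite inordK.
Qed.

Lemma nonlift_alphaS : nonlift_alpha m.+1.
Proof.
have m_gt0 : 0 < m by apply: ltnW.
exists rotation, m; split=> //.
- have [|e' [_ ee' e'e]] := inner_power_invertible (ext_stable_nil _) epow_rotation_inner _ m_gt0.
    by rewrite ext_gen.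
  by exists e'; split; apply/feqP.
- by exists (gen ord0); apply/feqP => x; rewrite epow_rotation_inner.
- move=> k /andP[k0 km] /(inner_free_pull1 (coordf int X (inord 1))) /ffunP/(_ (inord 1)).
  rewrite !ffunE eqxx.
  have /(mag1_eqr _ (coordf int X (inord 1))) -> // := epow_rotation (inord 1) (ltnW km).
  have n1 : inord 1 <> ord0 :> X by move=> /(congr1 val) /=; rewrite inordK //; lia.
  case: eqP => // _; rewrite inordK; last by lia.
  rewrite add1n km mag1_gen ffunE; case: eqP => // /(congr1 val) /=.
  by rewrite !inordK //; lia.
- move=> w /feqP h; have hc := conj_pow_central epow_rotation_inner h (inord 1).
  have := @mag1_central int X [::] (fun=> erefl) (coordf int X ord0) (coordf int X (inord 1)) _ _
    hc erefl.
  have n1 : (inord 1 == ord0 :> X) = false.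
    by apply/eqP=> /(congr1 val) /=; rewrite inordK //; lia.
  (* The coordinate of [z] along the circle is [m w_0 + 1], which cannot vanish for [m > 1]. *)
  rewrite !ffunE eqxx n1 mul0r mulr1 mag1_cat mag1_gen ffunE eqxx.
  have -> k : mag1 (coordf int X ord0) (conj_pow w rotation k) =
      (mag1 (coordf int X ord0) w * k%:Z)%R.
    elim: k => [|k IH] /=; first by rewrite mulr0.
    by rewrite mag1_cat mag1_ext pull1_rotation IH; lia.
  by move: (mag1 _ w) => e; have [e0|e0] := ltrP e 0%R; nia.
Qed.

End Rotation.

Theorem mainTheorem1 (n g : nat) (hn : 2 < n) (hg : 2 <= g) :
  [/\ nonlift_alpha n, nonlift_beta n, nonlift_gamma g & nonlift_delta g].
Proof.
split; [|exact: nonlift_betaP|exact: nonlift_gammaP|exact: nonlift_deltaP].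
by case: n hn => // n hn; apply: nonlift_alphaS.
Qed.
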